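(* Let $d\ge 1$ be an integer and let $U=S(I\otimes C_d)$ be the evolution operator of the Fourier walk on $\mathbb{Z}^d$, where $C_d$ is the $2d\times 2d$ matrix with entries $(C_d)_{j,k}=\frac{1}{\sqrt{2d}}\,\omega_{2d}^{jk}$ for $j,k=0,1,\dots,2d-1$, and $\omega_{2d}=\exp(2\pi i/(2d))$. Then localization does not occur for this quantum walk; that is, for every $\Psi_0\in\mathcal{H}$ and every $x\in\mathbb{Z}^d$, $\limsup_{n\to\infty}\|(U^n\Psi_0)(x)\|=0$.
   Context: Let $\mathcal{H}=\ell^2(\mathbb{Z}^d;\mathbb{C}^{2d})=\{\Psi:\mathbb{Z}^d\to\mathbb{C}^{2d} : \sum_{x\in\mathbb{Z}^d}\|\Psi(x)\|^2<\infty\}$, and let $|0\rangle,\dots,|2d-1\rangle$ be the standard basis of $\mathbb{C}^{2d}$. Let $e_0,\dots,e_{d-1}$ be the standard unit vectors of $\mathbb{Z}^d$. The shift operator is $S=\sum_{x\in\mathbb{Z}^d}\sum_{j=0}^{d-1}\bigl(|x-e_j\rangle\langle x|\otimes|2j\rangle\langle 2j|+|x+e_j\rangle\langle x|\otimes|2j+1\rangle\langle 2j+1|\bigr)$, $I$ is the identity on $\ell^2(\mathbb{Z}^d)$, and for a unitary $2d\times 2d$ coin matrix $C$ the evolution operator is $U=S(I\otimes C)$; equivalently $(U\Psi)(x)=\sum_{j=0}^{d-1}\bigl(|2j\rangle\langle 2j|C\Psi(x+e_j)+|2j+1\rangle\langle 2j+1|C\Psi(x-e_j)\bigr)$. Given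 an initial state $\Psi_0\in\mathcal{H}$, put $\Psi_n=U^n\Psi_0$. Localization occurs if and only if there exist $\Psi_0\in\mathcal{H}$ and $x\in\mathbb{Z}^d$ with $\limsup_{n\to\infty}\|\Psi_n(x)\|>0$. *)

(* Defs.v *)
From HB Require Import structures.
From mathcomp Require Import all_boot all_order all_algebra.
From mathcomp Require Import all_classical all_reals all_analysis.
From mathcomp Require Import complex.
Set Implicit Arguments. Unset Strict Implicit. Unset Printing Implicit Defensive.
Import Order.TTheory GRing.Theory Num.Theory.
Local Open Scope ring_scope.

Definition lattice (d : nat) := 'rV[int]_d.
Definition state (R : realType) (d : nat) := 'cV[R[i]]_(2 * d).

Definition config (R : realType) (d : nat) := lattice d -> state R d.

Definition vnorm (R : realType) (d : nat) (v : state R d) : R :=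
  Num.sqrt (\sum_(k < 2 * d) (ComplexField.Normc.normc (v k ord0)) ^+ 2).

Definition in_H (R : realType) (d : nat) (Psi : config R d) : Prop :=
  (\esum_(x in [set: lattice d]) ((vnorm (Psi x)) ^+ 2)%:E < +oo)%E.

Definition unit_vec (d j : nat) : lattice d := \row_(i < d) ((i : nat) == j)%:R.

(* Evolution operator U = S (I ⊗ C):
   (U Psi)(x) = sum_j ( |2j><2j| C Psi(x+e_j) + |2j+1><2j+1| C Psi(x-e_j) ).
   For the component c (c = 2j or 2j+1, j = c/2). *)
Definition evol (R : realType) (d : nat) (C : 'M[R[i]]_(2 * d))
    (Psi : config R d) : config R d :=
  fun x => \col_(c < 2 * d)
    (C *m Psi (if odd c then x - unit_vec d c./2 else x + unit_vec d c./2)) c ord0.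

Definition walk (R : realType) (d : nat) (C : 'M[R[i]]_(2 * d)) (n : nat)
    (Psi0 : config R d) : config R d := iter n (evol C) Psi0.

(* omega_{2d} = exp(2 pi i / (2d)) = cos(pi/d) + i sin(pi/d). *)
Definition omega (R : realType) (d : nat) : R[i] :=
  (cos (pi / d%:R) +i* sin (pi / d%:R))%C.

Definition fourier_coin (R : realType) (d : nat) : 'M[R[i]]_(2 * d) :=
  \matrix_(j < 2 * d, k < 2 * d)
    (((Num.sqrt ((2 * d)%:R : R))^-1)%:C * omega R d ^+ (j * k))%C.

(* Main.v *)
Require Import Defs.
From HB Require Import structures.
From mathcomp Require Import all_boot all_order all_algebra all_field.
From mathcomp Require Import all_classical all_reals all_analysis.
From mathcomp Require Import complex.
From mathcomp Require Import ring lra zify.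
Import Order.TTheory GRing.Theory Num.Theory.
Import ComplexField.Normc.
Import numFieldNormedType.Exports.
Set Implicit Arguments.
Unset Strict Implicit.
Unset Printing Implicit Defensive.
Local Open Scope classical_set_scope.
Local Open Scope ring_scope.

(** Choose a direction v in {1,-1}^d.  On the plane waves with a given
    quasi-momentum transverse to v, the walk becomes a walk V on the line with
    steps +1 and -1, and translations E of the line commute with V.

    By Cayley-Hamilton there is a nonzero polynomial p with p(V, E) = 0; since
    every fiber of V is a unitary, hence normal, matrix, a p of minimal degree
    in E is squarefree, so that p and its derivative p_E generate a nonzero
    polynomial r(V).  Let X be the position operator.  Commuting X with
    p(V, E) = 0, conjugating by powers of V and summing over n time steps, the
    group-velocity terms telescope to X itself, which is bounded at each fixed
    site: this gives n (p_E)(V, E) V^n psi = O(1) at every site.  Hence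
    r(V) V^n psi tends to 0 pointwise.

    The factors of r are then removed one at a time.  Modulo V - lambda, the
    characteristic polynomial becomes a polynomial in E alone, and a factor
    E - z can be cancelled because V^n psi stays bounded in l^2.  For
    lambda <> 0 that polynomial in E is nonzero as soon as the square submatrix
    of the coin on the components moving by -1 is nonsingular (no flat band).
    For the Fourier coin, v can be chosen so that this submatrix is a
    Vandermonde matrix: its indices are the residues of (d + 1) i modulo 2 d.

    Averaging the plane waves over the transverse quasi-momenta, one coordinate
    at a time and by dominated convergence, yields the decay for point
    masses, and unitarity extends it to all of l^2. *)

(** * Polynomials in commuting shifts *)

(** Packaged as a predicate so that [poly_act_action] can be applied twice, first adjoining the time
    shift to the scalars and then the space shift. *)
Definition is_action (K : pzRingType) (M : zmodType) (s : K -> M -> M) :=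
  [/\ forall a, {morph s a : x y / x + y},
      forall x, {morph s^~ x : a b / a + b},
      forall x, s 1 x = x
    & forall a b x, s (a * b) x = s a (s b x)].

Section PolyAction.
Variables (K : comNzRingType) (M : zmodType).

Definition poly_act (s : K -> M -> M) (f : M -> M) (p : {poly K}) (x : M) : M :=
  \sum_(i < size p) s p`_i (iter i f x).

Implicit Types (p q : {poly K}) (x y : M).
Variables (s : K -> M -> M) (f : M -> M).
Hypothesis s_act : is_action s.
Hypothesis fD : {morph f : x y / x + y}.
Hypothesis fs : forall a x, f (s a x) = s a (f x).

Let sD a : {morph s a : x y / x + y}. Proof. by case: s_act. Qed.
Let sDl x : {morph s^~ x : a b / a + b}. Proof. by case: s_act. Qed.

Lemma act0r a : s a 0 = 0.
Proof. by apply: (addrI (s a 0)); rewrite -sD !addr0. Qed.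

Lemma act0l x : s 0 x = 0.
Proof. by apply: (addrI (s 0 x)); rewrite -sDl !addr0. Qed.

Lemma act_sumr a (I : Type) (r : seq I) (P : pred I) F :
  s a (\sum_(i <- r | P i) F i) = \sum_(i <- r | P i) s a (F i).
Proof. by apply: (big_morph (s a)); [exact: sD|exact: act0r]. Qed.

Let f0 : f 0 = 0.
Proof. by apply: (addrI (f 0)); rewrite -fD !addr0. Qed.

Lemma poly_act_wide p n x : (size p <= n)%N ->
  poly_act s f p x = \sum_(i < n) s p`_i (iter i f x).
Proof.
move=> le_pn; rewrite /poly_act (big_ord_widen n (fun i => s p`_i (iter i f x))) //.
rewrite [RHS](bigID (fun i : 'I_n => (i < size p)%N)) /= [X in _ + X]big1 ?addr0 //.
by move=> i; rewrite -leqNgt => h; rewrite nth_default // act0l.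
Qed.

Lemma poly_actDl x : {morph (poly_act s f)^~ x : p q / p + q}.
Proof.
move=> p q; pose n := maxn (size p) (size q).
rewrite (@poly_act_wide (p + q) n) ?(leq_trans (size_polyD _ _)) //.
rewrite (@poly_act_wide p n) ?leq_maxl // (@poly_act_wide q n) ?leq_maxr //.
by rewrite -big_split; apply: eq_bigr => i _; rewrite coefD sDl.
Qed.

Let iterfD i : {morph iter i f : x y / x + y}.
Proof. by elim: i => [//|i IH] x y; rewrite !iterS IH fD. Qed.

Lemma poly_actDr p : {morph poly_act s f p : x y / x + y}.
Proof.
by move=> x y; rewrite -big_split; apply: eq_bigr => i _; rewrite iterfD sD.
Qed.

Lemma poly_actC a x : poly_act s f a%:P x = s a x.
Proof.
by rewrite (@poly_act_wide _ 1) ?size_polyC_leq1 // big_ord1 coefC eqxx.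
Qed.

Lemma poly_actXr p x : poly_act s f (p * 'X) x = poly_act s f p (f x).
Proof.
have h : (size (p * 'X)%R <= (size p).+1)%N.
  by apply: (leq_trans (size_polyMleq _ _)); rewrite size_polyX addn2.
rewrite (@poly_act_wide _ _ x h) big_ord_recl coefMX eqxx act0l add0r.
by apply: eq_bigr => i _; rewrite lift0 coefMX iterSr.
Qed.

Lemma poly_act_commf p x : poly_act s f p (f x) = f (poly_act s f p x).
Proof.
rewrite /poly_act (big_morph f fD f0); apply: eq_bigr => i _.
by rewrite fs -iterS iterSr.
Qed.

Lemma poly_actZ a p x : poly_act s f (a *: p) x = s a (poly_act s f p x).
Proof.
rewrite (@poly_act_wide _ _ x (size_scale_leq a p)) /poly_act act_sumr.
by apply: eq_bigr => i _; rewrite coefZ; case: s_act => _ _ _ ->.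
Qed.

Lemma poly_actM p q x : poly_act s f (p * q) x = poly_act s f p (poly_act s f q x).
Proof.
elim/poly_ind: p x => [|p c IH] x; first by rewrite mul0r /poly_act size_poly0 !big_ord0.
rewrite mulrDl !poly_actDl mul_polyC poly_actZ poly_actC; congr (_ + _).
by rewrite mulrAC !poly_actXr IH poly_act_commf.
Qed.

Lemma poly_act_action : is_action (poly_act s f).
Proof.
split; [exact: poly_actDr | exact: poly_actDl | | exact: poly_actM].
by move=> x; rewrite poly_actC; case: s_act.
Qed.

Lemma poly_act_comm (g : M -> M) p x : {morph g : x y / x + y} ->
  (forall a x, g (s a x) = s a (g x)) -> (forall x, g (f x) = f (g x)) ->
  g (poly_act s f p x) = poly_act s f p (g x).
Proof.
move=> gD gs gf; have g0 : g 0 = 0 by apply: (addrI (g 0)); rewrite -gD !addr0.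
rewrite /poly_act (big_morph g gD g0); apply: eq_bigr => i _; rewrite gs.
by congr (s _ _); elim: (i : nat) => //= n <-; rewrite gf.
Qed.

End PolyAction.

(** * Polynomials in the time and space shifts acting on space-time arrays *)

Section ArrayAction.
Variables (C : comNzRingType) (Z : lmodType C).
Implicit Types (a : nat -> int -> Z) (p q : {poly {poly C}}).

Definition scale_arr (c : C) a : nat -> int -> Z := fun n m => c *: a n m.
Definition tshift a : nat -> int -> Z := fun n m => a n.+1 m.
Definition xshift a : nat -> int -> Z := fun n m => a n (m + 1).

(* The inner variable of [p] acts as the time shift, the outer one as the space shift. *)
Definition arr_act p a : nat -> int -> Z :=
  poly_act (poly_act scale_arr tshift) xshift p a.

Let arrD a b n m : (a + b) n m = a n m + b n m. Proof. by []. Qed.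

Lemma scale_arr_action : is_action scale_arr.
Proof.
split=> [c a b|a c1 c2|a|c1 c2 a]; apply/funext => n; apply/funext => m;
  rewrite /scale_arr ?arrD.
- exact: scalerDr.
- exact: scalerDl.
- exact: scale1r.
- by rewrite scalerA.
Qed.

Let time_action : is_action (poly_act scale_arr tshift).
Proof. by apply: (poly_act_action scale_arr_action). Qed.

Let xshift_time (p : {poly C}) a :
  xshift (poly_act scale_arr tshift p a) = poly_act scale_arr tshift p (xshift a).
Proof. by apply: poly_act_comm. Qed.

Lemma arr_act_action : is_action arr_act.
Proof. by apply: (poly_act_action time_action) => // p a; exact: xshift_time. Qed.

Lemma arr_actM p q a : arr_act (p * q) a = arr_act p (arr_act q a).
Proof. by case: arr_act_action. Qed.

Lemma arr_actDl p q a : arr_act (p + q) a = arr_act p a + arr_act q a.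
Proof. by case: arr_act_action => _ + _ _; apply. Qed.

Lemma arr_actDr p a b : arr_act p (a + b) = arr_act p a + arr_act p b.
Proof. by case: arr_act_action => + _ _ _; apply. Qed.

Lemma arr_act1 a : arr_act 1 a = a.
Proof. by case: arr_act_action. Qed.

Lemma arr_act0r p : arr_act p 0 = 0.
Proof. exact: act0r arr_act_action _. Qed.

Lemma arr_act0l a : arr_act 0 a = 0.
Proof. exact: act0l arr_act_action _. Qed.

Lemma arr_actX a : arr_act 'X a = xshift a.
Proof.
rewrite -['X]mul1r /arr_act (poly_actXr _ time_action).
by rewrite -[poly_act _ _ _ _]/(arr_act 1 _) arr_act1.
Qed.

Lemma arr_actC (p : {poly C}) a :
  arr_act p%:P a = poly_act scale_arr tshift p a.
Proof. exact: (poly_actC _ time_action). Qed.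

Lemma arr_actCX a : arr_act ('X%:P) a = tshift a.
Proof.
rewrite arr_actC -['X]mul1r (poly_actXr _ scale_arr_action).
by rewrite (poly_actC _ scale_arr_action); apply/funext => n; apply/funext => m; exact: scale1r.
Qed.

Lemma arr_actCC (c : C) a : arr_act (c%:P%:P) a = scale_arr c a.
Proof. by rewrite arr_actC (poly_actC _ scale_arr_action). Qed.

Lemma arr_act_sumr p (I : Type) (r : seq I) (P : pred I) (F : I -> nat -> int -> Z) :
  arr_act p (\sum_(i <- r | P i) F i) = \sum_(i <- r | P i) arr_act p (F i).
Proof. exact: act_sumr arr_act_action _ _ _ _ _. Qed.

Let iter_tshift k a n m : iter k tshift a n m = a (n + k)%N m.
Proof.
elim: k a n => [|k IH] a n; first by rewrite addn0.
by rewrite iterSr IH /tshift addnS.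
Qed.

Let iter_xshift k a n m : iter k xshift a n m = a n (m + k%:Z).
Proof.
elim: k a m => [|k IH] a m; first by rewrite addr0.
by rewrite iterSr IH /xshift -addrA -addn1 PoszD.
Qed.

Lemma arr_actE p a n m : arr_act p a n m =
  \sum_(k < size p) \sum_(i < size p`_k) p`_k`_i *: a (n + i)%N (m + k%:Z).
Proof.
have sumE (I : Type) (r : seq I) (F : I -> nat -> int -> Z) n' m' :
  (\sum_(i <- r) F i) n' m' = \sum_(i <- r) F i n' m'.
  by elim/big_rec2: _ => // i x y _ <-.
rewrite /arr_act /poly_act sumE; apply: eq_bigr => k _; rewrite sumE.
apply: eq_bigr => i _; rewrite /scale_arr; congr (_ *: _).
by rewrite iter_tshift iter_xshift.
Qed.

End ArrayAction.

Section ArrayActionClosed.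
Variables (C : comNzRingType) (Z : lmodType C).
Implicit Types (a : nat -> int -> Z) (p : {poly {poly C}}).

(** [arr_act p] is built from sums, scalings and the two shifts only. Both pointwise decay and
    boundedness in l^2 are propagated through this principle. *)
Lemma arr_act_closed (Q : (nat -> int -> Z) -> Prop) p a : Q 0 ->
  (forall a b, Q a -> Q b -> Q (a + b)) ->
  (forall c a, Q a -> Q (scale_arr c a)) -> (forall a, Q a -> Q (tshift a)) ->
  (forall a, Q a -> Q (xshift a)) -> Q a -> Q (arr_act p a).
Proof.
move=> Q0 QD Qs Qt Qx Qa; rewrite /arr_act /poly_act.
have Qiter f n : (forall a, Q a -> Q (f a)) -> forall b, Q b -> Q (iter n f b).
  by move=> Qf b Qb; elim: n => //= n /Qf.
apply: big_ind => // k _; apply: big_ind => // i _; apply: Qs.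
by apply: (Qiter) => //; apply: (Qiter).
Qed.

Definition inner_size p : nat := \max_(k < size p) size (p`_k)%R.

(** Padding with zero coefficients turns the ragged double sum into one sum over a finite type,
    which is easier to exchange with other sums. *)
Lemma arr_act_pairs p a n m : arr_act p a n m =
  \sum_(x : 'I_(size p) * 'I_(inner_size p))
    p`_x.1`_x.2 *: a (n + x.2)%N (m + (x.1 : nat)%:Z).
Proof.
rewrite arr_actE -(pair_bigA _ (fun (k : 'I_(size p)) (i : 'I_(inner_size p)) =>
  p`_k`_i *: a (n + i)%N (m + (k : nat)%:Z))) /=.
apply: eq_bigr => k _; have le_k : (size (p`_k)%R <= inner_size p)%N.
  exact: (@leq_bigmax _ (fun k : 'I_(size p) => size p`_k)).
rewrite (big_ord_widen (inner_size p) (fun i => p`_k`_i *: a (n + i)%N (m + k%:Z))) //.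
rewrite [RHS](bigID (fun i : 'I_(inner_size p) => (i < size (p`_k)%R)%N)) /=.
rewrite [X in _ = _ + X]big1 ?addr0 // => i.
by rewrite -leqNgt => h; rewrite (nth_default _ h) scale0r.
Qed.

End ArrayActionClosed.

(** * The commutator of position with polynomials in the shifts *)

Section PositionOperator.
Variable C : comNzRingType.
Implicit Types (a : nat -> int -> C^o) (p : {poly {poly C}}).

Definition position a : nat -> int -> C^o := fun n m => m%:~R *: a n m.

(** Leibniz rule generated by [E X = X E + E]. The time shift commutes with position, so only the
    derivative in the outer variable appears. *)
Lemma arr_act_position p a :
  arr_act p (position a) = position (arr_act p a) + arr_act ('X * p^`()) a.
Proof.
have posD b1 b2 : position (b1 + b2) = position b1 + position b2.
  by apply/funext => n; apply/funext => m; exact: scalerDr.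
have actMX q b : arr_act (q * 'X) b = arr_act q (xshift b).
  by rewrite arr_actM arr_actX.
elim/poly_ind: p a => [|p c IH] a.
  rewrite deriv0 mulr0 !arr_act0l addr0; apply/funext => n; apply/funext => m.
  by rewrite /position [RHS]scaler0.
rewrite derivMXaddC !arr_actDl mulrDr mulrA arr_actDl !actMX posD -addrA.
have -> : xshift (position a) = position (xshift a) + xshift a.
  apply/funext => n; apply/funext => m; rewrite /xshift /position.
  by rewrite intrD [LHS]scalerDl [1 *: _]scale1r.
have -> : arr_act c%:P (position a) = position (arr_act c%:P a).
  rewrite !arr_actC; symmetry; apply: poly_act_comm => //.
  by move=> u b; apply/funext => n; apply/funext => m; exact: mulrCA.
rewrite arr_actDr IH -!addrA; congr (_ + _).
by rewrite ['X * p]mulrC actMX addrCA addrA addrC.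
Qed.

End PositionOperator.

(** * Vanishing sequences and the evolution *)

Section Vanishing.
Variable R : realType.
Implicit Types (f g : nat -> R[i]) (z : R[i]).

Lemma normc_ge0 z : 0 <= normc z.
Proof. by case: z => a b; exact: sqrtr_ge0. Qed.

Lemma normcD z1 z2 : normc (z1 + z2) <= normc z1 + normc z2.
Proof. exact: (@le_normcD R z1 z2). Qed.

Lemma normc_sum (I : Type) (r : seq I) (P : pred I) (F : I -> R[i]) :
  normc (\sum_(i <- r | P i) F i) <= \sum_(i <- r | P i) normc (F i).
Proof.
elim/big_rec2: _ => [|i y x _ h]; first by rewrite normc0.
by apply: (le_trans (normcD _ _)); rewrite lerD2l.
Qed.

(** Convergence to 0 is expressed through the real number [normc], so that no topology on [R[i]] is
    involved. *)
Definition vanishes f :=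
  forall e : R, 0 < e -> \forall n \near \oo, normc (f n) < e.

Lemma vanishes_le (h : nat -> R) f : h @ \oo --> 0 -> (forall n, normc (f n) <= h n) ->
  vanishes f.
Proof.
move=> h0 fh e e0; move/cvgrPdist_lt: h0 => /(_ e e0); apply: filterS => n.
rewrite sub0r normrN => /(le_lt_trans _); apply.
by apply: (le_trans (fh n)); exact: ler_norm.
Qed.

Lemma vanishes0 : vanishes (fun=> 0).
Proof. by move=> e e0; near=> n; rewrite normc0. Unshelve. all: by end_near. Qed.

Lemma vanishesD f g : vanishes f -> vanishes g -> vanishes (fun n => f n + g n).
Proof.
move=> f0 g0 e e0; have e2 : 0 < e / 2 by rewrite divr_gt0.
near=> n; apply: (le_lt_trans (normcD _ _)); rewrite [e]splitr.
by apply: ltrD; near: n; [exact: f0|exact: g0].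
Unshelve. all: by end_near. Qed.

Lemma vanishesZ z f : vanishes f -> vanishes (fun n => z * f n).
Proof.
move=> f0 e e0; have c0 : 0 < normc z + 1 by rewrite ltr_pwDr // normc_ge0.
near=> n; rewrite normcM; apply: (@le_lt_trans _ _ ((normc z + 1) * normc (f n))).
  by rewrite ler_wpM2r ?normc_ge0 // lerDl.
by rewrite mulrC -ltr_pdivlMr //; near: n; apply: f0; rewrite divr_gt0.
Unshelve. all: by end_near. Qed.

Lemma vanishes_sum (I : Type) (r : seq I) (P : pred I) (F : I -> nat -> R[i]) :
  (forall i, P i -> vanishes (F i)) -> vanishes (fun n => \sum_(i <- r | P i) F i n).
Proof.
move=> F0; elim: r => [|i r IH].
  suff -> : (fun n => \sum_(i <- [::] | P i) F i n) = (fun=> 0) by exact: vanishes0.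
  by apply/funext => n; rewrite big_nil.
suff -> : (fun n => \sum_(j <- i :: r | P j) F j n) =
    fun n => (if P i then F i n else 0) + \sum_(j <- r | P j) F j n.
  by apply: vanishesD => //; case: (boolP (P i)) => [/F0|_] //; exact: vanishes0.
by apply/funext => n; rewrite big_cons; case: ifP => //; rewrite add0r.
Qed.

Lemma vanishes_shift f k : vanishes f -> vanishes (fun n => f (n + k)%N).
Proof.
move=> f0 e /f0[M _ fM]; exists M => // n /= Mn.
by apply: fM => /=; exact: leq_trans Mn (leq_addr _ _).
Qed.

Lemma vanishes_unshift f : vanishes (fun n => f n.+1) -> vanishes f.
Proof. by move=> f0 e /f0[M _ fM]; exists M.+1 => // -[//|n] /=; exact: fM. Qed.

End Vanishing.

(** * Coin-and-shift evolutions over an arbitrary abelian group *)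

Section Evolution.
Variables (R : realType) (L : zmodType) (N : nat).
Implicit Types (y : 'cV[R[i]]_N) (psi phi : L -> 'cV[R[i]]_N) (W : 'M[R[i]]_N) (tau : 'I_N -> L).

(** The group [L] is left general to cover both the lattice and the line. [tau c] points to the site
    from which component [c] is read. *)
Definition gevol tau W psi : L -> 'cV[R[i]]_N :=
  fun x => \col_c (W *m psi (x + tau c)) c ord0.

Lemma gevolE tau W psi x c :
  gevol tau W psi x c ord0 = \sum_k W c k * psi (x + tau c) k ord0.
Proof. by rewrite /gevol !mxE. Qed.

Lemma gevol_shift tau W psi (y : L) :
  gevol tau W (fun x => psi (x + y)) = (fun x => gevol tau W psi (x + y)).
Proof. by apply/funext => x; apply/colP => c; rewrite !mxE addrAC. Qed.

Lemma gevol_sum tau W (I : Type) (r : seq I) (P : pred I)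
    (z : I -> R[i]) (F : I -> L -> 'cV[R[i]]_N) :
  gevol tau W (fun x => \sum_(i <- r | P i) z i *: F i x) =
  (fun x => \sum_(i <- r | P i) z i *: gevol tau W (F i) x).
Proof.
apply/funext => x; apply/colP => c; rewrite gevolE summxE.
under eq_bigr do rewrite summxE mulr_sumr.
rewrite exchange_big; apply: eq_bigr => i _; rewrite !mxE mulr_sumr.
by apply: eq_bigr => k _; rewrite mxE mulrCA.
Qed.

Lemma iter_gevol_sum tau W (I : Type) (r : seq I) (P : pred I)
    (z : I -> R[i]) (F : I -> L -> 'cV[R[i]]_N) n :
  iter n (gevol tau W) (fun x => \sum_(i <- r | P i) z i *: F i x) =
  (fun x => \sum_(i <- r | P i) z i *: iter n (gevol tau W) (F i) x).
Proof. by elim: n => //= n ->; exact: gevol_sum. Qed.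

Lemma iter_gevol_shift tau W psi (y : L) n :
  iter n (gevol tau W) (fun x => psi (x + y)) =
  (fun x => iter n (gevol tau W) psi (x + y)).
Proof. by elim: n => //= n ->; exact: gevol_shift. Qed.

Definition sqnorm (y : 'cV[R[i]]_N) : R := \sum_c normc (y c ord0) ^+ 2.

Lemma sqnorm_ge0 y : 0 <= sqnorm y.
Proof. by apply: sumr_ge0 => c _; exact: sqr_ge0. Qed.

Definition energy psi : \bar R := (\esum_(x in [set: L]) (sqnorm (psi x))%:E)%E.

Definition isometric W := forall y, sqnorm (W *m y) = sqnorm y.

(** The coin preserves the norm at each site. The shift then translates each component separately,
    which only permutes the terms of that component's sum. *)
Lemma energy_gevol tau W psi : isometric W ->
  energy (gevol tau W psi) = energy psi.
Proof.
move=> isoW; have E (phi : L -> 'cV[R[i]]_N) : energy phi =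
    (\sum_c \esum_(x in [set: L]) (normc (phi x c ord0) ^+ 2)%:E)%E.
  rewrite -esum_sum; last by move=> x c _ _; rewrite lee_fin sqr_ge0.
  by apply: eq_esum => x _; rewrite sumEFin.
transitivity (energy (fun x => W *m psi x)); last first.
  by apply: eq_esum => x _; rewrite isoW.
rewrite !E; apply: eq_bigr => c _.
rewrite [RHS](@reindex_esum _ _ _ [set: L] [set: L] (fun x => x + tau c)) //=.
- by apply: eq_esum => x _; rewrite mxE.
- by split=> // [x y _ _ /addIr //|y _]; exists (y - tau c); rewrite ?subrK.
Qed.

Lemma energy_iter tau W psi n : isometric W ->
  energy (iter n (gevol tau W) psi) = energy psi.
Proof. by move=> iW; elim: n => //= n IH; rewrite energy_gevol. Qed.

Lemma sqnorm_le_energy psi x : ((sqnorm (psi x))%:E <= energy psi)%E.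
Proof.
apply: esum_ge; exists [set x]; first by split.
by rewrite fsbig_set1.
Qed.

Lemma normc_le_sqnorm y c : normc (y c ord0) ^+ 2 <= sqnorm y.
Proof.
by rewrite /sqnorm (bigD1 c) //= lerDl; apply: sumr_ge0 => k _; exact: sqr_ge0.
Qed.

Lemma normc_le_energy psi B x c : (energy psi <= B%:E)%E ->
  normc (psi x c ord0) ^+ 2 <= B.
Proof.
move=> h; rewrite -lee_fin (le_trans _ h) // (le_trans _ (sqnorm_le_energy psi x)) //.
by rewrite lee_fin normc_le_sqnorm.
Qed.

Lemma energy_sum_le psi B (I : finType) (h : I -> L) : injective h ->
  (energy psi <= B%:E)%E -> \sum_i sqnorm (psi (h i)) <= B.
Proof.
move=> hI hB; rewrite -lee_fin (le_trans _ hB) // -sumEFin.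
apply: esum_ge; exists (range h); first by split=> //; exact: finite_image.
rewrite fsbig_image //; last by move=> x y _ _ /hI.
rewrite (_ : [set: I] = [set` index_enum I]); last first.
  by apply/seteqP; split=> // i _ /=; rewrite mem_index_enum.
by rewrite -fsbig_seq ?index_enum_uniq.
Qed.

End Evolution.
(** * Walks on the line *)

Section LineWalk.
Variables (R : realType) (N : nat) (W : 'M[R[i]]_N) (s : 'I_N -> bool).
Local Notation C := R[i].
Implicit Types (psi phi : int -> 'cV[C]_N) (p q : {poly {poly C}}).

Definition step (c : 'I_N) : int := if s c then -1 else 1.

Definition orbit_arr phi : nat -> int -> 'cV[C]_N :=
  fun n => iter n (gevol step W) phi.

Definition coord (a : nat -> int -> 'cV[C]_N) (c : 'I_N) : nat -> int -> C^o :=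
  fun n m => a n m c ord0.

(** This is the operator identity [p(V, E) = 0]. No summability is asked of [phi], so that plane
    waves and position-weighted states can be substituted. *)
Definition annihilates p := forall phi c, arr_act p (coord (orbit_arr phi) c) = 0.

Lemma annihilatesM q p : annihilates p -> annihilates (q * p).
Proof. by move=> pJ phi c; rewrite arr_actM pJ arr_act0r. Qed.

(** The evolution equations as a matrix over the shift polynomials, with ['X%:P] for time and ['X]
    for space. Rows of step -1 are multiplied by the space shift to avoid negative powers. *)
Definition walk_mx : 'M[{poly {poly C}}]_N :=
  \matrix_(c, k) if s c then (c == k)%:R * ('X%:P * 'X) - (W c k)%:P%:P
                 else (c == k)%:R * 'X%:P - (W c k)%:P%:P * 'X.

Lemma walk_mx_act phi c :
  \sum_k arr_act (walk_mx c k) (coord (orbit_arr phi) k) = 0.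
Proof.
set a := orbit_arr phi.
have sumE (F : 'I_N -> nat -> int -> C^o) n m : (\sum_k F k) n m = \sum_k F k n m.
  by elim/big_rec2: _ => // i x y _ <-.
have actN p b : arr_act (- p) b = - arr_act p b.
  by apply/eqP; rewrite -subr_eq0 opprK -arr_actDl addNr arr_act0l.
have actd q k b : arr_act ((c == k)%:R * q) b = if c == k then arr_act q b else 0.
  by rewrite mulr_natl; case: eqP => _; rewrite ?mulr1n // mulr0n arr_act0l.
have aE n m : a n.+1 m c ord0 = \sum_k W c k * a n (m + step c) k ord0.
  exact: gevolE.
apply/funext => n; apply/funext => m; rewrite sumE.
under eq_bigr => k _.
  have -> : arr_act (walk_mx c k) (coord a k) n m =
     (if c == k then a n.+1 (m + (s c)%:R) k ord0 else 0) -
       W c k * a n (m + (~~ s c)%:R) k ord0.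
    rewrite mxE; case: (s c); rewrite arr_actDl actN actd !arr_actM.
      rewrite arr_actCX arr_actX arr_actCC addr0.
      by rewrite -[LHS]/((if c == k then _ else _) n m - _); case: eqP.
    rewrite arr_actCX arr_actX arr_actCC addr0.
    by rewrite -[LHS]/((if c == k then _ else _) n m - _); case: eqP.
  over.
rewrite sumrB -big_mkcond /= (big_pred1 c) => [|k]; last exact: eq_sym.
rewrite aE; apply/eqP; rewrite subr_eq0; apply/eqP; apply: eq_bigr => k _.
by congr (_ * a n _ k ord0); rewrite /step; case: (s c); rewrite ?addr0 // addrK.
Qed.

(** Cayley-Hamilton: multiplying the system [walk_mx_act] by the adjugate leaves the determinant
    acting on each component. *)
Lemma det_walk_mx_annihilates : annihilates (\det walk_mx).
Proof.
move=> phi j; pose f k := coord (orbit_arr phi) k.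
have E k : (\det walk_mx *+ (j == k)) = \sum_c \adj walk_mx j c * walk_mx c k.
  by have /matrixP/(_ j k) := mul_adj_mx walk_mx; rewrite !mxE.
have : \sum_k arr_act (\det walk_mx *+ (j == k)) (f k) = 0.
  transitivity (\sum_c arr_act (\adj walk_mx j c) (\sum_k arr_act (walk_mx c k) (f k))).
    under [RHS]eq_bigr do rewrite arr_act_sumr.
    rewrite exchange_big; apply: eq_bigr => k _; rewrite E.
    rewrite (big_morph (fun q => arr_act q (f k)) (id1 := 0) (op1 := +%R)) //=.
    + by apply: eq_bigr => c _; rewrite arr_actM.
    + by move=> q1 q2; rewrite arr_actDl.
    + exact: arr_act0l.
  by rewrite big1 // => c _; rewrite walk_mx_act arr_act0r.
rewrite (bigD1 j) //= eqxx big1 ?addr0 // => k /negPf.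
by rewrite eq_sym => ->; rewrite mulr0n arr_act0l.
Qed.

Definition time_eval (lam : C) : {poly {poly C}} -> {poly C} :=
  map_poly (horner_eval lam).

(** Evaluating the time variable at [lam] is reduction modulo [V - lam]: by the factor theorem each
    coefficient differs from its value by a multiple of ['X - lam%:P]. *)
Lemma time_eval_factor lam p :
  exists q, p = map_poly polyC (time_eval lam p) + ('X - lam%:P)%:P * q.
Proof.
elim/poly_ind: p => [|p c [q pE]].
  by exists 0; rewrite /time_eval !rmorph0 mulr0 addr0.
have /factor_theorem[r rE] : root (c - c.[lam]%:P) lam.
  by rewrite /root hornerD hornerN hornerC subrr.
exists (q * 'X + r%:P).
rewrite /time_eval !rmorphD !rmorphM /= !map_polyX !map_polyC /= /horner_eval.
rewrite -/(time_eval lam p) [in LHS]pE mulrDl mulrDr -!addrA; congr (_ + _).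
rewrite [RHS]addrCA mulrA; congr (_ + _); first by rewrite polyCD.
by rewrite -!polyCD -polyCM [_ * r]mulrC -rE -polyCD addrC subrK.
Qed.

Hypothesis minor_nondegenerate : forall y : 'cV[C]_N,
  (forall c, ~~ s c -> y c ord0 = 0) ->
  (forall c, s c -> (W *m y) c ord0 = 0) -> y = 0.

(** At space variable 0 the rows of step -1 become rows of [- W], and the others become [lam] times
    unit rows. A kernel vector is thus supported on [s] and killed by the submatrix of [W] on
    [s]. *)
Lemma time_eval_det_neq0 lam : lam != 0 -> time_eval lam (\det walk_mx) != 0.
Proof.
move=> lam0; suff : (time_eval lam (\det walk_mx)).[0] != 0.
  by apply: contra => /eqP ->; rewrite horner0.
rewrite /time_eval -det_map_mx -[_.[0]]/(horner_eval 0 _) -det_map_mx -det_tr.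
apply/det0P => -[v /eqP v0 vB]; apply: v0.
suff : v^T = 0 by move/(congr1 trmx); rewrite trmxK trmx0.
have BvE c : \sum_k (if s c then - W c k else (c == k)%:R * lam) * v ord0 k = 0.
  move/rowP/(_ c): vB; rewrite !mxE => vB; rewrite -[RHS]vB; apply: eq_bigr => k _.
  rewrite !mxE mulrC; congr (_ * _); case: (s c).
    rewrite !(rmorphB, rmorphM, rmorph_nat) /= !map_polyC map_polyX /=.
    by rewrite /horner_eval !(hornerX, hornerC) !mulr0 sub0r.
  rewrite !(rmorphB, rmorphM, rmorph_nat) /= !map_polyC map_polyX /=.
  by rewrite /horner_eval !(hornerX, hornerC) mulr0 subr0.
have v0 c : ~~ s c -> v ord0 c = 0.
  move=> sc; move: (BvE c); rewrite (negPf sc) (bigD1 c) //= eqxx mul1r big1 ?addr0.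
    by move/eqP; rewrite mulf_eq0 (negPf lam0) => /eqP.
  by move=> k; rewrite eq_sym => /negPf ->; rewrite !mul0r.
apply: minor_nondegenerate => c sc; rewrite mxE ?v0 //.
move: (BvE c); rewrite sc => /eqP; rewrite -oppr_eq0 -sumrN => /eqP h; rewrite -[RHS]h.
by apply: eq_bigr => k _; rewrite mxE mulNr opprK.
Qed.

End LineWalk.

(** * Decay of l^2-bounded arrays and cancellation of factors in the space shift *)

Section VanishingIdeal.
Variable R : realType.
Local Notation C := R[i].
Implicit Types (b : nat -> int -> C^o) (p q : {poly {poly C}}).

Definition arr_vanishes b := forall m, vanishes (b ^~ m).

Lemma arr_act_vanishes p b : arr_vanishes b -> arr_vanishes (arr_act p b).
Proof.
apply: arr_act_closed => [m|b1 b2 h1 h2 m|c b1 h m|b1 h m|b1 h m].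
- exact: vanishes0.
- exact: (vanishesD (h1 m) (h2 m)).
- exact: (vanishesZ c (h m)).
- have := vanishes_shift 1 (h m); congr vanishes.
  by apply/funext => n; rewrite addn1.
- exact: (h (m + 1)).
Qed.

(** An l^2 bound on the line, uniform in time. Testing it on finite injective families makes
    invariance under translation immediate. *)
Definition sq_bounded b := exists B : R, forall n K (h : 'I_K -> int), injective h ->
  \sum_i normc (b n (h i)) ^+ 2 <= B.

Lemma sq_bounded_arr_act p b : sq_bounded b -> sq_bounded (arr_act p b).
Proof.
apply: arr_act_closed => [|b1 b2 [B1 h1] [B2 h2]|c b1 [B h]|b1 [B h]|b1 [B h]].
- by exists 0 => n K h _; rewrite big1 // => i _; rewrite normc0 expr0n.
- exists (2 * B1 + 2 * B2) => n K h hI.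
  apply: (@le_trans _ _ (\sum_i (2 * normc (b1 n (h i)) ^+ 2 + 2 * normc (b2 n (h i)) ^+ 2))).
    apply: ler_sum => i _; have /(@le_trans _ _ _ _ _) := normcD (b1 n (h i)) (b2 n (h i)).
    set x := normc (b1 _ _); set y := normc (b2 _ _) => /(_ _ (lexx _)) le_xy.
    apply: (@le_trans _ _ ((x + y) ^+ 2)).
      by rewrite ler_pXn2r ?nnegrE ?addr_ge0 ?normc_ge0.
    by have := sqr_ge0 (x - y); nra.
  by rewrite big_split -!mulr_sumr; apply: lerD; rewrite ler_pM2l ?h1 ?h2.
- exists (normc c ^+ 2 * B) => n K k kI; under eq_bigr do rewrite normcM exprMn.
  by rewrite -mulr_sumr ler_wpM2l ?sqr_ge0 ?h.
- by exists B => n K k kI; exact: h.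
- by exists B => n K k kI; apply: h => i j /addIr /kI.
Qed.

Lemma normcB (z1 z2 : C) : normc (z1 - z2) <= normc z1 + normc z2.
Proof. by rewrite -[normc z2](@normcN R z2); exact: normcD. Qed.

Lemma normc_nneg (x : R) : 0 <= x -> normc x%:C%C = x.
Proof. by move=> x0; rewrite /= expr0n addr0 sqrtr_sqr ger0_norm. Qed.

(** A value of size [e] at [h 0] would, at late times, force values of size at least [e / 2] at the
    first [K] sites of the chain. This contradicts the l^2 bound once [K (e / 2)^2 > B]. *)
Lemma vanishes_of_propagation b (h : nat -> int) : sq_bounded b -> injective h ->
  (forall k, exists2 d, vanishes d &
     forall n, normc (b n (h k)) <= normc (b n (h k.+1)) + normc (d n)) ->
  vanishes (b ^~ (h 0%N)).
Proof.
move=> [B bB] hI hstep e e0.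
have hk k : exists2 d, vanishes d &
    forall n, normc (b n (h 0%N)) <= normc (b n (h k)) + normc (d n).
  elim: k => [|k [d d0 hd]].
    by exists (fun=> 0) => [|n]; [exact: vanishes0|rewrite normc0 addr0].
  have [d' d'0 hd'] := hstep k.
  exists (fun n => (normc (d n) + normc (d' n))%:C%C) => [e' e'0|n].
    have e2 : 0 < e' / 2 by rewrite divr_gt0.
    near=> n; rewrite normc_nneg ?addr_ge0 ?normc_ge0 // [e']splitr.
    by apply: ltrD; near: n; [exact: d0|exact: d'0].
  rewrite normc_nneg ?addr_ge0 ?normc_ge0 //.
  by move: (hd n) (hd' n); lra.
have e2 : 0 < (e / 2) ^+ 2 by rewrite exprn_gt0 ?divr_gt0.
have [K BK] : exists K : nat, B < K%:R * (e / 2) ^+ 2.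
  exists (Num.bound `|B / (e / 2) ^+ 2|); rewrite -ltr_pdivrMr //.
  by apply: le_lt_trans (ler_norm _) _; exact: archi_boundP (normr_ge0 _).
have [d hd] := choice (fun k => (let: ex_intro2 d d0 dn := hk k in ex_intro _ d (conj d0 dn))
  : exists d, vanishes d /\ forall n, normc (b n (h 0%N)) <= normc (b n (h k)) + normc (d n)).
have dK : \forall n \near \oo, forall k : 'I_K, normc (d k n) < e / 2.
  by apply: filter_forall => k; apply: (hd k).1; rewrite divr_gt0.
near=> n; rewrite ltNge; apply/negP => le_e.
suff : K%:R * (e / 2) ^+ 2 <= \sum_(i < K) normc (b n (h i)) ^+ 2.
  have hiI : injective (fun i : 'I_K => h i) by move=> i j /hI /val_inj.
  by move=> /le_trans /(_ (bB n K _ hiI)); rewrite leNgt BK.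
rewrite mulr_natl -[X in _ *+ X]card_ord -sumr_const; apply: ler_sum => k _.
rewrite ler_pXn2r ?nnegrE ?normc_ge0 ?divr_ge0 ?ltW //.
have dk : normc (d k n) < e / 2.
  by apply: (near dK n).
have := (hd k).2 n; move: dk le_e; lra.
Unshelve. all: by end_near. Qed.

(* On the side where |z| does not contract, a bounded-energy approximate
   solution of b(m + 1) = z b(m) would keep its size along a whole half-line. *)
Lemma vanishes_xfactor (z : C) b : sq_bounded b ->
  arr_vanishes (arr_act ('X - z%:P%:P) b) -> arr_vanishes b.
Proof.
move=> bB hv m.
have hv' m' : vanishes (fun n => b n (m' + 1) - z * b n m').
  have := hv m'; congr vanishes; apply/funext => n.
  have -> : arr_act ('X - z%:P%:P) b = xshift b - scale_arr z b.
    apply/eqP; rewrite eq_sym subr_eq -arr_actCC -arr_actDl subrK.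
    by rewrite arr_actX.
  by [].
have [z1|z1] := leP 1 (normc z).
  have := @vanishes_of_propagation b (fun k => m + k%:Z) bB.
  rewrite /= addr0; apply; first by move=> i j /addrI [].
  move=> k; exists (fun n => b n (m + k%:Z + 1) - z * b n (m + k%:Z)) => // n.
  rewrite -addn1 PoszD addrA; set u := b n _; set v := b n _.
  apply: (@le_trans _ _ (normc z * normc u)); first by rewrite ler_peMl ?normc_ge0.
  rewrite -normcM -{1}[z * u](subKr v); exact: normcB.
have := @vanishes_of_propagation b (fun k => m - k%:Z) bB.
rewrite /= subr0; apply; first by move=> i j /addrI /oppr_inj [].
move=> k; exists (fun n => b n (m - k.+1%:Z + 1) - z * b n (m - k.+1%:Z)) => // n.
rewrite -addn1 PoszD opprD addrA subrK; set u := b n _; set v := b n _.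
apply: (@le_trans _ _ (normc (z * v) + normc (u - z * v))).
  by rewrite -{1}[u](subrK (z * v)) addrC; exact: normcD.
by rewrite lerD2r normcM ler_piMl ?normc_ge0 // ltW.
Qed.

End VanishingIdeal.
(** * The commutator with the position operator *)

Section Commutator.
Variables (R : realType) (N : nat) (W : 'M[R[i]]_N) (s : 'I_N -> bool).
Local Notation C := R[i].
Local Notation V := (gevol (step s) W).
Local Notation orb := (orbit_arr W s).
Implicit Types (psi phi : int -> 'cV[C]_N) (p q : {poly {poly C}}).

Definition pos_mul psi : int -> 'cV[C]_N := fun m => m%:~R *: psi m.

(** The velocity operator, which measures the failure of [V] to commute with position; it preserves
    the energy because its entries are 1 or -1. *)
Definition drift psi : int -> 'cV[C]_N :=
  fun m => \col_c ((step s c)%:~R * psi m c ord0).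

Lemma gevol_pos_mul psi m :
  V (pos_mul psi) m = pos_mul (V psi) m + drift (V psi) m.
Proof.
apply/colP => c; rewrite gevolE [RHS]mxE [X in _ = X + _]mxE [X in _ = _ + X]mxE.
rewrite gevolE -mulrDl -intrD mulr_sumr.
by apply: eq_bigr => k _; rewrite mxE mulrCA.
Qed.

Lemma energy_drift psi : energy (drift psi) = energy psi.
Proof.
apply: eq_esum => m _; congr (_%:E); apply: eq_bigr => c _.
rewrite mxE normcM exprMn /step; case: (s c); last by rewrite normc1 expr1n mul1r.
by rewrite mulrN1z (@normcN R) normc1 expr1n mul1r.
Qed.

Lemma iter_gevolB n psi phi m :
  iter n V psi m - iter n V phi m = iter n V (fun m => psi m - phi m) m.
Proof.
elim: n m => //= n IH m; apply/colP => c; rewrite !mxE -sumrB.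
by apply: eq_bigr => k _; rewrite -IH !mxE mulrBr.
Qed.

Definition poly_orbit p phi : nat -> int -> 'cV[C]_N :=
  fun n m => \col_c arr_act p (coord (orb phi) c) n m.

Lemma poly_orbitE p phi n : poly_orbit p phi n =
  fun m => \sum_(x : 'I_(size p) * 'I_(inner_size p))
    p`_x.1`_x.2 *: orb phi (n + x.2)%N (m + (x.1 : nat)%:Z).
Proof.
apply/funext => m; apply/colP => c; rewrite mxE arr_act_pairs summxE.
by apply: eq_bigr => x _; rewrite mxE.
Qed.

Lemma orbit_arrD phi i n : orb (orb phi i) n = orb phi (i + n)%N.
Proof. by rewrite /orbit_arr addnC iterD. Qed.

Lemma iter_gevol_poly_orbit p phi n i :
  iter i V (poly_orbit p phi n) = poly_orbit p phi (n + i)%N.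
Proof.
rewrite !poly_orbitE iter_gevol_sum; apply/funext => m; apply: eq_bigr => x _.
rewrite (iter_gevol_shift (step s) W (orb phi (n + x.2)%N)); congr (_ *: _).
by rewrite -[iter _ _ _ _]/(orb _ i _) orbit_arrD addnAC.
Qed.

Variable phi0 : int -> 'cV[C]_N.
Hypothesis isoW : isometric W.
Hypothesis phi0_energy : (energy phi0 <= 1%:E)%E.
Hypothesis phi0_pos : pos_mul phi0 = fun=> 0.
Local Notation a := (orb phi0).

Let a_le1 n m c : normc (a n m c ord0) <= 1.
Proof.
have /(normc_le_energy m c) : (energy (a n) <= 1%:E)%E by rewrite energy_iter.
by rewrite -[leRHS](expr1n _ 2) ler_pXn2r ?nnegrE ?normc_ge0.
Qed.

(* Interpolates from V^n X phi0 = 0 to X V^n phi0 in n steps of bounded size. *)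
Definition transported_pos n t : int -> 'cV[C]_N := iter (n - t) V (pos_mul (a t)).
Local Notation H := transported_pos.

Lemma transported_pos0 n : H n 0 = fun=> 0.
Proof.
rewrite /transported_pos subn0 -[a 0%N]/phi0 phi0_pos.
elim: n => //= n ->; apply/funext => m; apply/colP => c.
by rewrite gevolE mxE big1 // => k _; rewrite mxE mulr0.
Qed.

(** The increment is the commutator of [V] with position, that is, the drift of [a t.+1], carried
    forward by [V]. Both operations preserve the energy, which is at most 1. *)
Lemma transported_pos_step n t m c : (t < n)%N ->
  normc (H n t m c ord0 - H n t.+1 m c ord0) <= 1.
Proof.
move=> lt_tn; have -> : H n t m c ord0 - H n t.+1 m c ord0 =
    iter (n - t.+1) V (drift (a t.+1)) m c ord0.
  rewrite /transported_pos -subnSK // iterSr.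
  transitivity ((iter (n - t.+1) V (V (pos_mul (a t))) m -
                 iter (n - t.+1) V (pos_mul (a t.+1)) m) c ord0).
    by rewrite [RHS]mxE; congr (_ + _); rewrite [RHS]mxE.
  rewrite iter_gevolB; apply: (congr1 (fun f => iter (n - t.+1) V f m c ord0)).
  by apply/funext => m'; rewrite gevol_pos_mul addrC addKr.
have /(normc_le_energy m c) :
    (energy (iter (n - t.+1) V (drift (a t.+1))) <= 1%:E)%E.
  by rewrite energy_iter // energy_drift energy_iter.
by rewrite -[leRHS](expr1n _ 2) ler_pXn2r ?nnegrE ?normc_ge0.
Qed.

(** The sum telescopes to the first [i] values minus [i] values ending just before [h (n + i)]. The
    former are close to [h 0 = 0] and the latter to [h (n + i)], so [n] enters the bound only
    through that end value. *)
Lemma window_sum_bound (h : nat -> C) n i :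
  (forall t, (t < n + i)%N -> normc (h t - h t.+1) <= 1) -> h 0%N = 0 ->
  normc (\sum_(l < n) (h l - h (l + i)%N)) <= i%:R * (i%:R + (i%:R + normc (h (n + i)%N))).
Proof.
move=> h1 h0; have E : \sum_(l < n) (h l - h (l + i)%N) =
    \sum_(l < i) h l - \sum_(l < i) h (n + l)%N.
  have split_sum m k : \sum_(l < m + k) h l = \sum_(l < m) h l + \sum_(l < k) h (m + l)%N.
    by rewrite big_split_ord.
  rewrite sumrB; apply/eqP; rewrite subr_eq addrAC eq_sym subr_eq -split_sum addnC.
  by rewrite split_sum; apply/eqP; congr (_ + _); apply: eq_bigr => l _; rewrite addnC.
have fwd l : (l <= n + i)%N -> normc (h l) <= l%:R.
  elim: l => [|l IH] le_l; first by rewrite h0 normc0.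
  have := normcB (h l) (h l - h l.+1); rewrite subKr => /le_trans; apply.
  by rewrite -natr1 lerD ?IH ?h1 // ltnW.
have bwd l : (l <= n + i)%N -> normc (h (n + i - l)%N) <= l%:R + normc (h (n + i)%N).
  elim: l => [|l IH] le_l; first by rewrite subn0 add0r.
  have := normcD (h (n + i - l.+1)%N - h (n + i - l)%N) (h (n + i - l)%N).
  rewrite subrK => /le_trans; apply; rewrite -natr1 [_ + 1]addrC -addrA.
  by rewrite lerD ?IH 1?ltnW //; have := h1 (n + i - l.+1)%N; rewrite -subSn // subSS; apply; lia.
rewrite E; apply: (le_trans (normcB _ _)); rewrite mulrDr lerD //.
  apply: (le_trans (normc_sum _ _ _)); rewrite mulr_natl -[X in _ *+ X]card_ord -sumr_const.
  apply: ler_sum => l _; apply: (le_trans (fwd _ _)); first by have := ltn_ord l; lia.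
  by rewrite ler_nat ltnW.
apply: (le_trans (normc_sum _ _ _)); rewrite mulr_natl -[X in _ *+ X]card_ord -sumr_const.
apply: ler_sum => l _; have lt_li := ltn_ord l.
have -> : (n + l)%N = (n + i - (i - l))%N by lia.
by apply: (le_trans (bwd _ _)); [lia|rewrite lerD2r ler_nat leq_subr].
Qed.

Section Annihilator.
Variable p : {poly {poly C}}.
Hypothesis pJ : annihilates W s p.
Let P (x : 'I_(size p) * 'I_(inner_size p)) : C := p`_x.1`_x.2.

(** Apply [p(V, E) = 0] to [a l] and to its product with position. What remains equates the
    commutators of position with powers of [V] to [E p_E(V, E)] at [a l]. *)
Let commutator_at l m :
  \sum_x P x *: (pos_mul (a (l + x.2)) (m + (x.1 : nat)%:Z) -
                 orb (pos_mul (a l)) x.2 (m + (x.1 : nat)%:Z)) =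
  poly_orbit ('X * p^`()) phi0 l m.
Proof.
apply/colP => c; rewrite summxE.
have E0 : \sum_x P x * orb (pos_mul (a l)) x.2 (m + (x.1 : nat)%:Z) c ord0 = 0.
  have /(congr1 (fun b => b 0%N m)) := pJ (pos_mul (a l)) c.
  by rewrite arr_act_pairs.
have := arr_act_position p (coord (orb (a l)) c).
move/(congr1 (fun b => b 0%N m)); rewrite pJ arr_act_pairs => E1.
transitivity (\sum_x P x *: position (coord (orb (a l)) c) (0 + x.2)%N (m + (x.1 : nat)%:Z)).
  rewrite -[RHS]subr0 -[X in _ = _ - X]E0 -sumrB; apply: eq_bigr => x _.
  rewrite !mxE mulrBr; congr (_ * _ - _ * _).
  by rewrite /position /coord orbit_arrD.
rewrite E1 mxE -[LHS]/(_ *: 0 + arr_act _ _ 0%N m) scaler0 add0r !arr_act_pairs.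
by apply: eq_bigr => x _; rewrite /coord orbit_arrD.
Qed.

(** Apply [V^(n - l)] to [commutator_at]. The left side does not depend on [l], so the identity can
    be summed over [l < n]. *)
Let commutator_transported n l m c : (l <= n)%N ->
  arr_act ('X * p^`()) (coord a c) n m =
  - \sum_x P x * (H (n + x.2) l (m + (x.1 : nat)%:Z) c ord0 -
                  H (n + x.2) (l + x.2) (m + (x.1 : nat)%:Z) c ord0).
Proof.
move=> le_ln; rewrite -sumrN.
transitivity (poly_orbit ('X * p^`()) phi0 n m c ord0); first by rewrite mxE.
rewrite -(subnKC le_ln) -iter_gevol_poly_orbit.
have -> : poly_orbit ('X * p^`()) phi0 l = fun m => \sum_x P x *:
    ((fun m => pos_mul (a (l + x.2)) m - orb (pos_mul (a l)) x.2 m) (m + (x.1 : nat)%:Z)).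
  by apply/funext => m'; rewrite -commutator_at.
rewrite iter_gevol_sum summxE; apply: eq_bigr => x _.
rewrite mxE -mulrN; congr (_ * _).
rewrite (iter_gevol_shift (step s) W
  (fun m => pos_mul (a (l + x.2)) m - orb (pos_mul (a l)) x.2 m)).
rewrite -iter_gevolB /orbit_arr -iterD mxE opprB; congr (_ + _).
  by rewrite /transported_pos (_ : l + (n - l) + x.2 - (l + x.2) = n - l)%N //; lia.
by rewrite mxE /transported_pos (_ : l + (n - l) + x.2 - l = n - l + x.2)%N //; lia.
Qed.

(** Summing [commutator_transported] over [l < n] gives [n] times the quantity on the left and
    telescoping windows on the right; the latter stay bounded, hence decay like [1 / n]. *)
Lemma annihilates_deriv c : arr_vanishes (arr_act p^`() (coord a c)).
Proof.
suff h m : vanishes (fun n => arr_act ('X * p^`()) (coord a c) n m).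
  (* The extra factor [E] is undone by reading one site to the left. *)
  move=> m; have := h (m - 1); rewrite arr_actM arr_actX /xshift.
  by rewrite subrK.
(* This is [window_sum_bound] with [i = x.2]. The end value there is the position [m + x.1] times an
   amplitude of size at most 1. *)
pose B := \sum_x normc (P x) * (x.2%:R * (x.2%:R + (x.2%:R +
  normc ((m + (x.1 : nat)%:Z)%:~R : C)))).
have bound n : n%:R * normc (arr_act ('X * p^`()) (coord a c) n m) <= B.
  set Q := arr_act _ _ n m.
  have E : n%:R * Q = - \sum_x P x * \sum_(l < n)
     (H (n + x.2) l (m + (x.1 : nat)%:Z) c ord0 -
      H (n + x.2) (l + x.2) (m + (x.1 : nat)%:Z) c ord0).
    rewrite mulr_natl -[X in _ *+ X]card_ord -sumr_const.
    under [in RHS]eq_bigr do rewrite mulr_sumr.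
    rewrite [in RHS]exchange_big -sumrN; apply: eq_bigr => l _.
    by apply: commutator_transported; rewrite ltnW.
  have -> : n%:R * normc Q = normc (n%:R * Q).
    by rewrite normcM -(rmorph_nat (real_complex R)) normc_nneg.
  rewrite E (@normcN R); apply: (le_trans (normc_sum _ _ _)); apply: ler_sum => x _.
  rewrite normcM ler_wpM2l ?normc_ge0 //.
  pose h t := H (n + x.2) t (m + (x.1 : nat)%:Z) c ord0.
  apply: (le_trans (@window_sum_bound h n x.2 _ _)).
  - by move=> t lt_t; exact: transported_pos_step.
  - by rewrite /h transported_pos0 mxE.
  rewrite ler_wpM2l // !lerD2l /h /transported_pos subnn /pos_mul /= mxE normcM.
  by rewrite ler_piMr ?normc_ge0 ?a_le1.
(* [harmonic n] is [1 / (n + 1)], hence the passage to index [n + 1]. *)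
apply: vanishes_unshift; apply: (@vanishes_le _ (fun n => B * harmonic n)).
  by rewrite -[X in _ --> X](mulr0 B); apply: cvgMr; exact: cvg_harmonic.
by move=> n; rewrite ler_pdivlMr // mulrC; exact: bound.
Qed.

End Annihilator.

End Commutator.
(** * Unitary fibers *)

Section NormalMatrix.
Variable C : numClosedFieldType.

Definition adjmx m n (A : 'M[C]_(m, n)) : 'M[C]_(n, m) := (map_mx Num.conj A)^T.

Lemma adjmxM m n k (A : 'M[C]_(m, n)) (B : 'M[C]_(n, k)) :
  adjmx (A *m B) = adjmx B *m adjmx A.
Proof. by rewrite /adjmx map_mxM trmx_mul. Qed.

Lemma adjmxK m n (A : 'M[C]_(m, n)) : adjmx (adjmx A) = A.
Proof. by apply/matrixP => i j; rewrite !mxE conjCK. Qed.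

Lemma adjmx_mul_eq0 m n (A : 'M[C]_(m, n)) : adjmx A *m A = 0 -> A = 0.
Proof.
move=> /matrixP A0; apply/matrixP => i j; rewrite mxE.
have /eqP := A0 j j; rewrite !mxE psumr_eq0 => [/allP/(_ i)|k _].
  by rewrite mem_index_enum /= !mxE mulrC mul_conjC_eq0 => /(_ isT)/eqP.
by rewrite !mxE mulrC mul_conjC_ge0.
Qed.

(** For [B = adjmx A *m A], normality turns [adjmx B *m B] into a product containing [A *m A], so
    [B = 0] and then [A = 0]. *)
Lemma normal_nilpotent n (A : 'M[C]_n) :
  adjmx A *m A = A *m adjmx A -> A *m A = 0 -> A = 0.
Proof.
move=> nA A2; apply: adjmx_mul_eq0; apply: adjmx_mul_eq0.
by rewrite adjmxM adjmxK -mulmxA (mulmxA A) -nA -mulmxA A2 !mulmx0.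
Qed.

Lemma adjmx_horner n (A : 'M[C]_n.+1) q :
  adjmx (horner_mx A q) = horner_mx (adjmx A) (map_poly Num.conj q).
Proof.
elim/poly_ind: q => [|q c IH].
  by rewrite !rmorph0; apply/matrixP => i j; rewrite !mxE rmorph0.
rewrite rmorphD rmorphM /= horner_mx_X horner_mx_C rmorphD rmorphM /=.
rewrite map_polyX map_polyC /= rmorphD rmorphM /= horner_mx_X horner_mx_C -IH.
have -> : adjmx (horner_mx A q * A + c%:M) = adjmx (horner_mx A q * A) + (c^* )%:M.
  by apply/matrixP => i j; rewrite !mxE rmorphD rmorphMn /= eq_sym.
rewrite adjmxM; congr (_ + _).
have cA : comm_mx (adjmx A) (adjmx (horner_mx A q)).
  by rewrite /comm_mx IH; apply: comm_mx_horner.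
exact: cA.
Qed.

Lemma unitary_horner_normal n (A : 'M[C]_n.+1) q : adjmx A *m A = 1%:M ->
  adjmx (horner_mx A q) *m horner_mx A q = horner_mx A q *m adjmx (horner_mx A q).
Proof.
move=> uA; have uA' := mulmx1C uA.
rewrite adjmx_horner; apply: comm_mx_horner; apply: comm_horner_mx.
by rewrite /comm_mx uA uA'.
Qed.

End NormalMatrix.

(** * Infinitely many points on the unit circle *)

Section UnitCircle.
Variable C : numClosedFieldType.

Lemma natr_subi_neq0 n : (n%:R - 'i : C) != 0.
Proof.
apply/eqP => /eqP; rewrite subr_eq0 => /eqP E.
have : (n ^ 2).+1%:R = 0 :> C by rewrite -natr1 natrX E sqrCi addNr.
by move/eqP; rewrite pnatr_eq0.
Qed.

(** The Cayley transform of the natural numbers: distinct unimodular points obtained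
    algebraically. *)
Definition circle_point n : C := (n%:R + 'i) / (n%:R - 'i).

Lemma circle_point_unit n : circle_point n * (circle_point n)^* = 1.
Proof.
rewrite /circle_point rmorphM fmorphV rmorphD rmorphB /= conjCi rmorph_nat opprK.
have := natr_subi_neq0 n; have : (n%:R + 'i : C) != 0.
  by rewrite -(fmorph_eq0 Num.conj) rmorphD /= conjCi rmorph_nat natr_subi_neq0.
by move=> h1 h2; field; rewrite h1 h2.
Qed.

Lemma circle_point_inj : injective circle_point.
Proof.
move=> m n /eqP; rewrite /circle_point eqr_div ?natr_subi_neq0 // => /eqP E.
have : (m%:R - n%:R) * ('i *+ 2) = 0 :> C.
  by apply/eqP; rewrite -oppr_eq0; apply/eqP; move: E => /eqP; rewrite -subr_eq0 => /eqP <-; ring.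
move/eqP; rewrite mulf_eq0 subr_eq0 eqr_nat => /orP[/eqP //|].
by rewrite mulrn_eq0 /= (negPf (neq0Ci _)).
Qed.

Lemma poly_circle_eq0 (q : {poly C}) :
  (forall z, z * z^* = 1 -> q.[z] = 0) -> q = 0.
Proof.
move=> qz; apply/eqP/negPn/negP => q0.
have := max_poly_roots q0 (rs := map circle_point (iota 0 (size q))).
rewrite size_map size_iota ltnn => h; apply: notF; apply: h.
  by apply/allP => _ /mapP[n _ ->]; rewrite /root qz // circle_point_unit.
by rewrite map_inj_uniq ?iota_uniq //; exact: circle_point_inj.
Qed.

Lemma unit_circle_neq0 (z : C) : z * z^* = 1 -> z != 0.
Proof. by move=> z1; apply: contra_eq_neq z1 => ->; rewrite mul0r eq_sym oner_eq0. Qed.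

End UnitCircle.

(** * Plane waves and the unitary fibers of the line walk *)

Section Fibers.
Variables (R : realType) (N : nat) (W : 'M[R[i]]_N.+1) (s : 'I_N.+1 -> bool).
Local Notation C := R[i].
Local Notation V := (gevol (step s) W).
Local Notation orb := (orbit_arr W s).
Implicit Types (phi : int -> 'cV[C]_N.+1) (p q : {poly {poly C}}).

Definition fiber (z : C) : 'M[C]_N.+1 := \matrix_(c, k) (z ^ step s c * W c k).

Definition plane_wave (z : C) (y : 'cV[C]_N.+1) : int -> 'cV[C]_N.+1 :=
  fun m => z ^ m *: y.

Lemma orbit_plane_wave z y n : z != 0 ->
  orb (plane_wave z y) n = plane_wave z (fiber z ^+ n *m y).
Proof.
move=> z0; elim: n => [|n IH]; first by rewrite expr0 mul1mx.
rewrite /orbit_arr iterS -/(orb _ n) IH; apply/funext => m; apply/colP => c.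
rewrite gevolE exprS -mulmxA !mxE mulr_sumr; apply: eq_bigr => k _.
by rewrite !mxE expfzDr //; ring.
Qed.

(** On a plane wave [E] is the scalar [z] and [V] is the matrix [fiber z], so [p(V, E)] becomes a
    matrix polynomial. *)
Lemma arr_act_plane_wave p z y c m : z != 0 ->
  arr_act p (coord (orb (plane_wave z y)) c) 0%N m =
  z ^ m * (horner_mx (fiber z) p.[z%:P] *m y) c ord0.
Proof.
move=> z0.
have actT (q : {poly C}) u : arr_act q%:P (coord (orb (plane_wave z u)) c) 0%N m =
    z ^ m * (horner_mx (fiber z) q *m u) c ord0.
  elim/poly_ind: q u => [|q a IH] u.
    by rewrite arr_act0l rmorph0 mul0mx mxE mulr0.
  rewrite polyCD polyCM arr_actDl arr_actM arr_actCX arr_actCC.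
  have -> : tshift (coord (orb (plane_wave z u)) c) =
      coord (orb (plane_wave z (fiber z *m u))) c.
    apply/funext => n; apply/funext => m'; rewrite /tshift /coord.
    by rewrite (orbit_plane_wave _ n.+1 z0) (orbit_plane_wave _ n z0) exprSr -mulmxA.
  rewrite -[LHS]/(arr_act _ _ 0%N m + _) IH rmorphD rmorphM /= horner_mx_X horner_mx_C.
  rewrite mulmxDl mulmxA [in RHS]mxE mulrDr; congr (_ + _).
  by rewrite mul_scalar_mx !mxE /scale_arr /coord mxE -[LHS]/(_ * _) mulrCA.
elim/poly_ind: p => [|p q IH].
  by rewrite arr_act0l horner0 rmorph0 mul0mx mxE mulr0.
rewrite arr_actDl arr_actM arr_actX hornerMXaddC.
rewrite -[LHS]/(arr_act _ _ 0%N m + _) actT.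
have -> : xshift (coord (orb (plane_wave z y)) c) =
    scale_arr z (coord (orb (plane_wave z y)) c).
  apply/funext => n; apply/funext => m'; rewrite /xshift /coord /scale_arr.
  by rewrite !orbit_plane_wave // !mxE expfzDr // expr1z -[RHS]/(_ * _); ring.
rewrite -arr_actCC -arr_actM [_ * z%:P%:P]mulrC arr_actM arr_actCC.
rewrite -[scale_arr _ _ _ _]/(z * arr_act p (coord (orb (plane_wave z y)) c) 0%N m) IH.
rewrite rmorphD rmorphM /= horner_mx_C mulmxDl [in RHS]mxE mulrDr; congr (_ + _).
by rewrite -mulmxE mul_mx_scalar -scalemxAl [in RHS]mxE mulrCA.
Qed.

Definition finite_range (G : (int -> 'cV[C]_N.+1) -> C) := exists r : seq (C * int * 'I_N.+1),
  forall phi, G phi = \sum_(t <- r) t.1.1 * phi t.1.2 t.2 ord0.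

Lemma finite_rangeZ z G : finite_range G -> finite_range (fun phi => z * G phi).
Proof.
move=> [r rE]; exists [seq (z * t.1.1, t.1.2, t.2) | t <- r] => phi.
by rewrite rE big_map mulr_sumr; apply: eq_bigr => t _; rewrite mulrA.
Qed.

Lemma finite_range_sum (I : finType) (G : I -> (int -> 'cV[C]_N.+1) -> C) :
  (forall i, finite_range (G i)) -> finite_range (fun phi => \sum_i G i phi).
Proof.
move=> Gfr; have [r rE] := choice Gfr; exists (flatten [seq r i | i <- index_enum I]) => phi.
by rewrite big_flatten big_map; apply: eq_bigr => i _; rewrite rE.
Qed.

Lemma finite_range_orbit n m c : finite_range (fun phi => orb phi n m c ord0).
Proof.
elim: n m c => [|n IH] m c.
  by exists [:: (1, m, c)] => phi; rewrite big_seq1 mul1r.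
have E : (fun phi => orb phi n.+1 m c ord0) =
    (fun phi => \sum_k W c k * orb phi n (m + step s c) k ord0).
  by apply/funext => phi; rewrite /orbit_arr iterS gevolE.
by rewrite E; apply: finite_range_sum => k; exact: finite_rangeZ.
Qed.

(* A finite-range functional applied to plane waves is a Laurent polynomial in
   [z]; if it vanishes on the circle, so do its coefficients. *)
Lemma finite_range_eq0 G : finite_range G ->
  (forall z y, z * z^* = 1 -> G (plane_wave z y) = 0) -> forall phi, G phi = 0.
Proof.
move=> [r rE] G0 phi.
(* Multiplying by [z ^ K] clears the negative exponents of the Laurent polynomial. *)
have [K rK] : exists K : nat, forall t, t \in r -> 0 <= t.1.2 + K%:Z.
  elim: (r) => [|t r' [K h]]; first by exists 0%N.
  exists (K + `|t.1.2|)%N => u; rewrite inE => /orP[/eqP ->|/h].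
    by move: (t.1.2 : int) => x; lia.
  by move: (t.1.2 : int) (u.1.2 : int) => x y; lia.
pose e (t : C * int * 'I_N.+1) := absz (t.1.2 + K%:Z).
pose Q k := \sum_(t <- r | t.2 == k) t.1.1 *: 'X^(e t) : {poly C}.
have Q0 k : Q k = 0.
  apply: poly_circle_eq0 => z z1.
  have z0 : z != 0 by exact: unit_circle_neq0.
  rewrite /Q horner_sum; have := G0 z (delta_mx k ord0) z1; rewrite rE => Gz.
  rewrite -[RHS](mulr0 (z ^ K%:Z)) -[X in _ * X]Gz mulr_sumr big_mkcond big_seq [RHS]big_seq.
  apply: eq_bigr => t tr; rewrite /plane_wave !mxE eqxx andbT; case: eqP => _;
    last by rewrite !mulr0.
  by rewrite hornerZ hornerXn mulr1 mulrCA -expfzDr // exprnP /e gez0_abs ?rK // addrC.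
pose J := (\max_(t <- r) e t).+1.
(* This linear form sends ['X^j] to the component [k] of [phi (j - K)]. It therefore recovers from
   [Q k] the part of [G phi] that reads component [k]. *)
pose ell k (q : {poly C}) := \sum_(j < J) q`_j * phi (j%:Z - K%:Z) k ord0.
have ellD k : {morph ell k : q1 q2 / q1 + q2}.
  by move=> q1 q2; rewrite -big_split; apply: eq_bigr => j _; rewrite coefD mulrDl.
have ell0 k : ell k 0 = 0 by apply: big1 => j _; rewrite coef0 mul0r.
rewrite rE (partition_big (fun t => t.2) xpredT) //=; apply: big1 => k _.
transitivity (ell k (Q k)); last by rewrite Q0 ell0.
rewrite /Q (big_morph _ (ellD k) (ell0 k)) big_seq_cond [RHS]big_seq_cond.
apply: eq_bigr => t /andP[tr /eqP tk].
have lt_J : (e t < J)%N by rewrite ltnS; exact: leq_bigmax_seq.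
rewrite /ell (bigD1 (Ordinal lt_J)) //= big1 => [|j /negPf neq].
  rewrite coefZ coefXn eqxx mulr1 addr0 tk; congr (_ * phi _ _ _).
  by rewrite /e gez0_abs ?rK // addrK.
by rewrite coefZ coefXn (_ : (j == e t :> nat) = false) ?mulr0 ?mul0r.
Qed.

Hypothesis unitaryW : adjmx W *m W = 1%:M.

Lemma fiber_unitary z : z * z^* = 1 -> adjmx (fiber z) *m fiber z = 1%:M.
Proof.
move=> z1; rewrite -unitaryW; apply/matrixP => i j; rewrite !mxE.
have z0 : z != 0 by exact: unit_circle_neq0.
apply: eq_bigr => k _; rewrite !mxE rmorphM /= mulrACA -[RHS]mul1r; congr (_ * _).
by rewrite fmorphXz -expfzMl mulrC z1 exp1rz.
Qed.

(** Each value of [p(V, E) phi] depends linearly on finitely many values of [phi], so by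
    [finite_range_eq0] it is enough to test unimodular plane waves. *)
Lemma annihilates_fiberP p : annihilates W s p <->
  (forall z, z * z^* = 1 -> horner_mx (fiber z) p.[z%:P] = 0).
Proof.
split=> [pJ z z1|pz phi c].
  have z0 : z != 0 by exact: unit_circle_neq0.
  apply/matrixP => c k; have := arr_act_plane_wave p (delta_mx k ord0) c 0 z0.
  rewrite pJ expr0z mul1r -colE mxE => <-.
  by rewrite mxE.
apply/funext => n; apply/funext => m.
(* Restarting the orbit at [orb phi n] reduces the claim to time 0. *)
have -> : arr_act p (coord (orb phi) c) n m = arr_act p (coord (orb (orb phi n)) c) 0%N m.
  by rewrite !arr_act_pairs; apply: eq_bigr => x _; rewrite /coord orbit_arrD.
apply: (@finite_range_eq0 (fun phi => arr_act p (coord (orb phi) c) 0%N m)).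
  have E : (fun phi => arr_act p (coord (orb phi) c) 0%N m) = (fun phi =>
      \sum_(x : 'I_(size p) * 'I_(inner_size p))
       p`_x.1`_x.2 * orb phi x.2 (m + (x.1 : nat)%:Z) c ord0).
    by apply/funext => psi; rewrite arr_act_pairs.
  by rewrite E; apply: finite_range_sum => x; apply: finite_rangeZ; exact: finite_range_orbit.
move=> z y z1; have z0 : z != 0 by exact: unit_circle_neq0.
by rewrite arr_act_plane_wave // pz // mul0mx mxE mulr0.
Qed.

(** On the circle each fiber of [p] is a polynomial in a unitary matrix, hence normal, and a normal
    matrix of square zero is zero. *)
Lemma annihilates_sqr p : annihilates W s (p * p) -> annihilates W s p.
Proof.
move=> /annihilates_fiberP p2; apply/annihilates_fiberP => z z1.
apply: normal_nilpotent.
  by apply: unitary_horner_normal; exact: fiber_unitary.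
by have := p2 z z1; rewrite hornerM rmorphM.
Qed.

End Fibers.
(** * Decay on the line *)

Section AlgebraicFactors.
Variable R : realType.
Local Notation C := R[i].

Lemma unitary_isometric n (W : 'M[C]_n) : adjmx W *m W = 1%:M -> isometric W.
Proof.
move=> uW y; have E (v : 'cV[C]_n) : (sqnorm v)%:C%C = (adjmx v *m v) ord0 ord0.
  rewrite mxE /sqnorm rmorph_sum; apply: eq_bigr => c _.
  by rewrite !mxE rmorphXn /= mulrC -normCK.
apply: (@complexI R); rewrite !E adjmxM -mulmxA (mulmxA (adjmx W)) uW mul1mx.
by [].
Qed.

Lemma deriv_neq0 (u : {poly {poly C}}) : (1 < size u)%N -> u^`() != 0.
Proof.
move=> u1; have u0 : u != 0 by rewrite -size_poly_gt0 ltnW.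
apply/eqP => /polyP/(_ (size u).-2); rewrite coef_deriv coef0 => /polyP h.
have E : ((size u).-2.+1 = (size u).-1)%N by case: (size u) u1 => [|[|]].
move/eqP: u0; apply; apply/eqP; rewrite -lead_coef_eq0 lead_coefE -E; apply/eqP/polyP => j.
by have /eqP := h j; rewrite coefMn coef0 mulrn_eq0 => /eqP.
Qed.

Lemma map_polyC_factor (r : seq C) :
  map_poly polyC (\prod_(z <- r) ('X - z%:P)) =
  \prod_(z <- r) ('X - z%:P%:P) :> {poly {poly C}}.
Proof.
rewrite rmorph_prod; apply: eq_bigr => z _.
by rewrite rmorphB /= map_polyX map_polyC.
Qed.

End AlgebraicFactors.

Section LineDecay.
Variables (R : realType) (N : nat) (W : 'M[R[i]]_N.+1) (s : 'I_N.+1 -> bool).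
Local Notation C := R[i].
Implicit Types (p q : {poly {poly C}}).
Hypothesis unitaryW : adjmx W *m W = 1%:M.
Hypothesis minor_nondegenerate : forall y : 'cV[C]_N.+1,
  (forall c, ~~ s c -> y c ord0 = 0) ->
  (forall c, s c -> (W *m y) c ord0 = 0) -> y = 0.

(** Take [p] of least size in [E]. A repeated factor [g] would write [p] as [h g^2] up to a scalar;
    then the square of [h g] annihilates, so the smaller [h g] does too by [annihilates_sqr]. *)
Lemma separable_annihilator :
  exists p, [/\ p != 0, annihilates W s p & separable_poly p].
Proof.
pose good n := `[< exists p, [/\ p != 0, annihilates W s p & size p = n] >].
have exgood : exists n, good n.
  exists (size (\det (walk_mx W s))); apply/asboolP; exists (\det (walk_mx W s)).
  split=> //; last exact: det_walk_mx_annihilates.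
  apply: contraNneq (time_eval_det_neq0 minor_nondegenerate (oner_neq0 C)) => ->.
  by rewrite /time_eval rmorph0.
case: (ex_minnP exgood) => n /asboolP[p [p0 pJ <-]] min_p.
exists p; split=> //; apply/separable_polyP; split=> [u v uv_p|u _]; last exact: deriv_neq0.
rewrite coprimep_def; apply/negPn/negP => g1.
pose g := gcdp u v; have gg_p : g * g %| p.
  by apply: dvdp_trans uv_p; rewrite dvdp_mul ?dvdp_gcdl ?dvdp_gcdr.
(* The coefficients are polynomials in time, not a field, so the quotient exists only after scaling
   by a nonzero [c]. *)
have /Pdiv.Idomain.dvdpP[[c h] /= c0 cp] := gg_p.
have cp0 : c *: p != 0 by rewrite -size_poly_eq0 size_scale // size_poly_eq0.
have hg0 : h * g != 0 by apply: contraNneq cp0 => hg; rewrite cp mulrA hg mul0r.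
have g0 : g != 0 by apply: contraNneq hg0 => ->; rewrite mulr0.
have hgJ : annihilates W s (h * g).
  apply: annihilates_sqr => //.
  have -> : h * g * (h * g) = (c *: h) * p.
    by rewrite -scalerAl scalerAr cp; ring.
  exact: annihilatesM.
have := min_p (size (h * g)); rewrite leqNgt => /(_ _)/negP; apply.
  by apply/asboolP; exists (h * g).
rewrite -(size_scale p c0) cp mulrA [X in (_ < X)%N]size_mul //.
have : (1 < size g)%N by rewrite ltn_neqAle eq_sym g1 size_poly_gt0.
by case: (size g) => [|[|k]] // _; rewrite !addnS /= ltnS leq_addr.
Qed.

Variable b : nat -> int -> C^o.
Hypothesis b_bounded : sq_bounded b.
Local Notation vanishing q := (arr_vanishes (arr_act q b)).

Lemma vanishing_xprod (r : seq C) q :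
  vanishing (\prod_(z <- r) ('X - z%:P%:P) * q) -> vanishing q.
Proof.
elim: r => [|z r IH]; first by rewrite big_nil mul1r.
rewrite big_cons -mulrA arr_actM => h; apply: IH.
by apply: vanishes_xfactor h; exact: sq_bounded_arr_act.
Qed.

Lemma vanishing_const (c : C) q : c != 0 -> vanishing (c%:P%:P * q) -> vanishing q.
Proof.
move=> c0 /(arr_act_vanishes (c^-1)%:P%:P); rewrite -arr_actM mulrA -!polyCM.
by rewrite mulVf // !polyC1 mul1r.
Qed.

Hypothesis b_char : arr_act (\det (walk_mx W s)) b = 0.

(** For [lam <> 0] the determinant, which kills [b], is modulo [V - lam] a nonzero polynomial in
    [E]; its linear factors are cancelled by [vanishing_xprod]. For [lam = 0] the factor is a mere
    time shift. *)
Lemma vanishing_tfactor (lam : C) q :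
  vanishing (('X - lam%:P)%:P * q) -> vanishing q.
Proof.
have [->|lam0] := eqVneq lam 0 => hq.
  move=> m; apply: vanishes_unshift; have := hq m.
  by rewrite subr0 arr_actM arr_actCX.
pose D := \det (walk_mx W s); have bD : arr_act D b = 0 := b_char.
have [S DE] := time_eval_factor lam D.
have E0 := time_eval_det_neq0 minor_nondegenerate lam0.
have [r rE] := closed_field_poly_normal (time_eval lam D).
apply: (@vanishing_xprod r); apply: (@vanishing_const (lead_coef (time_eval lam D))).
  by rewrite lead_coef_eq0.
rewrite mulrA -map_polyC_factor -[_%:P%:P](map_polyC polyC) -rmorphM /= mul_polyC -rE.
have -> : map_poly polyC (time_eval lam D) = D - S * ('X - lam%:P)%:P.
  by rewrite {2}DE mulrC addrK.
rewrite mulrBl => m.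
have := arr_act_vanishes (- S) hq m; rewrite -arr_actM.
congr vanishes; apply/funext => n.
have Dq : arr_act (D * q) b = 0 by rewrite mulrC arr_actM bD arr_act0r.
by rewrite arr_actDl Dq add0r !mulNr mulrA.
Qed.

Lemma vanishing_time_poly (r : {poly C}) q : r != 0 ->
  vanishing (r%:P * q) -> vanishing q.
Proof.
move=> r0; have [t tE] := closed_field_poly_normal r.
rewrite tE -mul_polyC polyCM -mulrA => /vanishing_const; rewrite lead_coef_eq0 => /(_ r0).
elim: t {tE} => [|z t IH]; first by rewrite big_nil mul1r.
by rewrite big_cons polyCM -mulrA => /vanishing_tfactor.
Qed.

End LineDecay.

(** Bezout for a separable annihilator [p] gives [u p + v p_E = r], where [r] is a nonzero
    polynomial in time alone. The [p] term is zero, the [p_E] term decays, and [vanishing_time_poly]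
    removes [r]. *)
Theorem line_decay (R : realType) (N : nat) (W : 'M[R[i]]_N) (s : 'I_N -> bool)
    (phi : int -> 'cV[R[i]]_N) : adjmx W *m W = 1%:M ->
  (forall y : 'cV[R[i]]_N, (forall c, ~~ s c -> y c ord0 = 0) ->
     (forall c, s c -> (W *m y) c ord0 = 0) -> y = 0) ->
  (energy phi <= 1%:E)%E -> (forall m, m != 0 -> phi m = 0) ->
  forall m c, vanishes (fun n => orbit_arr W s phi n m c ord0).
Proof.
case: N W s phi => [|N] W s phi uW mW phi1 phi_supp m c; first by case: c.
have isoW := unitary_isometric uW.
have bB : sq_bounded (coord (orbit_arr W s phi) c).
  exists 1 => n K h hI; apply: (@le_trans _ _ (\sum_i sqnorm (orbit_arr W s phi n (h i)))).
    by apply: ler_sum => i _; exact: normc_le_sqnorm.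
  by apply: energy_sum_le => //; rewrite energy_iter.
have [p [p0 pJ sep_p]] := separable_annihilator uW mW.
have pos0 : pos_mul phi = fun=> 0.
  apply/funext => k; rewrite /pos_mul.
  by have [->|/phi_supp ->] := eqVneq k 0; rewrite ?scale0r ?scaler0.
have dv := annihilates_deriv isoW phi1 pos0 pJ c.
have /Bezout_coprimepP[[u v] /=] : coprimep p p^`() by rewrite unlock in sep_p.
rewrite -size_poly_eq1 => /size_poly1P[r r0 rE].
have : arr_vanishes (arr_act (1 : {poly {poly R[i]}}) (coord (orbit_arr W s phi) c)).
  apply: (vanishing_time_poly mW bB (det_walk_mx_annihilates _ _ _ _) r0).
  rewrite mulr1 -rE arr_actDl !arr_actM pJ arr_act0r add0r.
  exact: arr_act_vanishes.
by rewrite arr_act1; apply.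
Qed.

(** * Averages over the circle *)

Section Cis.
Variable R : realType.
Implicit Types (t : R) (m : int).

Definition cis t : R[i] := (cos t +i* sin t)%C.

Lemma cisD t1 t2 : cis (t1 + t2) = cis t1 * cis t2.
Proof. by rewrite /cis cosD sinD; apply/eqP; rewrite eq_complex /= addrC eqxx addrC eqxx. Qed.

Lemma cis0 : cis 0 = 1.
Proof. by rewrite /cis cos0 sin0. Qed.

Lemma cis_neq0 t : cis t != 0.
Proof.
apply/eqP => h; have := cisD t (- t).
by rewrite addrN cis0 h mul0r => /eqP; rewrite oner_eq0.
Qed.

Lemma cisN t : cis (- t) = (cis t)^-1.
Proof.
by apply: (mulfI (cis_neq0 t)); rewrite -cisD addrN cis0 divff ?cis_neq0.
Qed.

Lemma cisMn t n : cis (n%:R * t) = cis t ^+ n.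
Proof.
elim: n => [|n IH]; first by rewrite mul0r cis0.
by rewrite -natr1 mulrDl mul1r cisD IH exprSr.
Qed.

Lemma cisMz t m : cis (m%:~R * t) = cis t ^ m.
Proof.
case: m => n; first exact: cisMn.
by rewrite NegzE mulrNz mulNr cisN cisMn exprnN.
Qed.

Lemma cis_unit t : cis t * (cis t)^* = 1.
Proof.
by rewrite -normCK normc_def /= cos2Dsin2 sqrtr1 expr1n.
Qed.

End Cis.

Section CircleAverage.
Variable R : realType.
Implicit Types (f g : R -> R[i]).
Local Notation mu := (@lebesgue_measure R).
Local Notation Re := (@complex.Re R).
Local Notation Im := (@complex.Im R).
Local Notation I01 := (`[0, 1]%classic : set R).

Definition ccontinuous f :=
  continuous (fun t => Re (f t)) /\ continuous (fun t => Im (f t)).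

(** The mean over a full turn, with [t] counting turns. Real and imaginary parts are integrated
    separately. *)
Definition avg f : R[i] :=
  ((\int[mu]_(t in I01) Re (f t)) +i* (\int[mu]_(t in I01) Im (f t)))%C.

Let integrable_of_cont (h : R -> R) : continuous h -> mu.-integrable I01 (EFin \o h).
Proof.
move=> ch; apply: continuous_compact_integrable; first exact: segment_compact.
exact: continuous_subspaceT.
Qed.

Lemma ccontinuousZ z f : ccontinuous f -> ccontinuous (fun t => z * f t).
Proof.
move=> [c1 c2]; case: z => a b; split => t.
  rewrite (_ : (fun t => _) = fun t => a * Re (f t) - b * Im (f t)).
    by apply: cvgB; apply: cvgM; (apply: cvg_cst || exact: c1 || exact: c2).
  by apply/funext => u; case: (f u).
rewrite (_ : (fun t => _) = fun t => a * Im (f t) + b * Re (f t)).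
  by apply: cvgD; apply: cvgM; (apply: cvg_cst || exact: c1 || exact: c2).
by apply/funext => u; case: (f u).
Qed.

Lemma ccontinuousD f g : ccontinuous f -> ccontinuous g ->
  ccontinuous (fun t => f t + g t).
Proof.
move=> [f1 f2] [g1 g2]; split => t.
  rewrite (_ : (fun t => _) = fun t => Re (f t) + Re (g t)).
    by apply: cvgD; [exact: f1|exact: g1].
  by apply/funext => u; case: (f u) (g u) => a b [].
rewrite (_ : (fun t => _) = fun t => Im (f t) + Im (g t)).
  by apply: cvgD; [exact: f2|exact: g2].
by apply/funext => u; case: (f u) (g u) => a b [].
Qed.

Lemma ccontinuous0 : ccontinuous (fun=> 0).
Proof. by split => t; exact: cvg_cst. Qed.

Lemma ccontinuous_sum (J : finType) (F : J -> R -> R[i]) :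
  (forall j, ccontinuous (F j)) -> ccontinuous (fun t => \sum_j F j t).
Proof.
move=> cF; elim: (index_enum J) => [|j r IH].
  rewrite (_ : (fun t => _) = fun=> 0); first exact: ccontinuous0.
  by apply/funext => t; rewrite big_nil.
rewrite (_ : (fun t => _) = fun t => F j t + \sum_(i <- r) F i t).
  exact: ccontinuousD.
by apply/funext => t; rewrite big_cons.
Qed.

Lemma avg0 : avg (fun=> 0) = 0.
Proof. by rewrite /avg /= !Rintegral_cst // mul0r. Qed.

Lemma avgZ z f : ccontinuous f -> avg (fun t => z * f t) = z * avg f.
Proof.
move=> [c1 c2]; have [i1 i2] := (integrable_of_cont c1, integrable_of_cont c2).
case: z => a b; rewrite /avg; apply/eqP; rewrite eq_complex /=; apply/andP; split; apply/eqP.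
  rewrite -!RintegralZl // -RintegralB //; last 2 first.
    by apply: integrable_of_cont => t; apply: cvgM; [exact: cvg_cst|exact: c1].
    by apply: integrable_of_cont => t; apply: cvgM; [exact: cvg_cst|exact: c2].
  by apply: eq_Rintegral => t _; case: (f t).
rewrite -!RintegralZl // -RintegralD //; last 2 first.
  by apply: integrable_of_cont => t; apply: cvgM; [exact: cvg_cst|exact: c2].
  by apply: integrable_of_cont => t; apply: cvgM; [exact: cvg_cst|exact: c1].
by apply: eq_Rintegral => t _; case: (f t).
Qed.

Lemma avgD f g : ccontinuous f -> ccontinuous g ->
  avg (fun t => f t + g t) = avg f + avg g.
Proof.
move=> [f1 f2] [g1 g2]; apply/eqP; rewrite eq_complex /=.
rewrite -!RintegralD //; do 1?exact: integrable_of_cont.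
by apply/andP; split; apply/eqP; apply: eq_Rintegral => t _; case: (f t) (g t) => a b [].
Qed.

Lemma avg_sum (J : finType) (F : J -> R -> R[i]) : (forall j, ccontinuous (F j)) ->
  avg (fun t => \sum_j F j t) = \sum_j avg (F j).
Proof.
move=> cF; suff [_ ->] : ccontinuous (fun t => \sum_(j <- index_enum J) F j t) /\
  avg (fun t => \sum_(j <- index_enum J) F j t) = \sum_(j <- index_enum J) avg (F j) by [].
elim: (index_enum J) => [|j r [IHc IH]].
  rewrite big_nil (_ : (fun t => _) = fun=> 0); last by apply/funext => t; rewrite big_nil.
  by split; [exact: ccontinuous0|exact: avg0].
rewrite big_cons (_ : (fun t => _) = fun t => F j t + \sum_(i <- r) F i t).
  by split; [exact: ccontinuousD|rewrite avgD // IH].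
by apply/funext => t; rewrite big_cons.
Qed.

Let measure_I01 : fine (mu I01) = 1.
Proof. by rewrite lebesgue_measure_itv /= lte_fin ltr01 /= oppr0 addr0. Qed.

Lemma avg_const z : avg (fun=> z) = z.
Proof.
case: z => a b.
by rewrite /avg /= !Rintegral_cst // -[LHS]/(_ +i* _)%C measure_I01 !mulr1.
Qed.

Lemma Re_le_normc (z : R[i]) : `|Re z| <= normc z.
Proof.
case: z => a b /=; rewrite -sqrtr_sqr ler_sqrt ?addr_ge0 ?sqr_ge0 //.
by rewrite lerDl sqr_ge0.
Qed.

Lemma Im_le_normc (z : R[i]) : `|Im z| <= normc z.
Proof.
case: z => a b /=; rewrite -sqrtr_sqr ler_sqrt ?addr_ge0 ?sqr_ge0 //.
by rewrite lerDr sqr_ge0.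
Qed.

Lemma normc_le_ReIm (z : R[i]) : normc z <= `|Re z| + `|Im z|.
Proof.
case: z => a b /=; rewrite -[leRHS]ger0_norm ?addr_ge0 // -sqrtr_sqr.
rewrite ler_sqrt ?sqr_ge0 // sqrrD !real_normK ?num_real // addrAC lerDl.
by rewrite mulrn_wge0 ?mulr_ge0.
Qed.

Let normr_Rint_le (h : R -> R) (B : R) : continuous h -> (forall t, `|h t| <= B) ->
  `|\int[mu]_(t in I01) h t| <= B.
Proof.
move=> ch hB; apply: (le_trans (le_normr_Rintegral _ (integrable_of_cont ch))) => //.
have -> : B = \int[mu]_(t in I01) (cst B t) by rewrite Rintegral_cst // measure_I01 mulr1.
apply: le_Rintegral => //.
  apply: integrable_of_cont => t; apply: cvg_norm; exact: ch.
by apply: integrable_of_cont => t; exact: cvg_cst.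
Qed.

(** The factor 2 comes from bounding the two parts separately; what matters later is that the bound
    is uniform in time. *)
Lemma normc_avg_le f (B : R) : ccontinuous f -> (forall t, normc (f t) <= B) ->
  normc (avg f) <= 2 * B.
Proof.
move=> [c1 c2] fB; apply: (le_trans (normc_le_ReIm _)); rewrite mulr_natl mulr2n.
apply: lerD; apply: normr_Rint_le => // t; apply: le_trans (fB t).
  exact: Re_le_normc.
exact: Im_le_normc.
Qed.

Let Rint_cvg0 (h : nat -> R -> R) (B : R) : (forall n, continuous (h n)) ->
  (forall n t, `|h n t| <= B) -> (forall t, h ^~ t @ \oo --> 0) ->
  (fun n => \int[mu]_(t in I01) h n t) @ \oo --> 0.
Proof.
move=> ch hB h0.
have [||||||_ _] := @dominated_convergence _ _ _ mu I01 _ (fun n t => (h n t)%:E)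
  (cst 0%E) (cst B%:E).
- by [].
- by move=> n; have /integrableP[] := integrable_of_cont (ch n).
- exact: measurable_cst.
- by apply: aeW => t _ /=; apply: cvg_EFin; [exact: nearW|exact: h0].
- by apply: (@integrable_of_cont (cst B)) => t; exact: cvg_cst.
- by apply: aeW => t n _ /=; rewrite lee_fin.
rewrite integral_cst // mul0e => /fine_cvg; exact.
Qed.

Lemma vanishes_avg (f : nat -> R -> R[i]) (B : R) : (forall n, ccontinuous (f n)) ->
  (forall n t, normc (f n t) <= B) -> (forall t, vanishes (f ^~ t)) ->
  vanishes (fun n => avg (f n)).
Proof.
move=> cf fB f0.
have R0 : (fun n => \int[mu]_(t in I01) Re (f n t)) @ \oo --> 0.
  apply: (@Rint_cvg0 (fun n t => Re (f n t)) B) => [n|n t|t]; first by case: (cf n).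
    exact: le_trans (Re_le_normc _) (fB n t).
  apply/cvgrPdist_lt => e e0; have := f0 t e e0; apply: filterS => n.
  by rewrite sub0r normrN; apply: le_lt_trans; exact: Re_le_normc.
have I0 : (fun n => \int[mu]_(t in I01) Im (f n t)) @ \oo --> 0.
  apply: (@Rint_cvg0 (fun n t => Im (f n t)) B) => [n|n t|t]; first by case: (cf n).
    exact: le_trans (Im_le_normc _) (fB n t).
  apply/cvgrPdist_lt => e e0; have := f0 t e e0; apply: filterS => n.
  by rewrite sub0r normrN; apply: le_lt_trans; exact: Im_le_normc.
apply: (@vanishes_le _ (fun n => `|Re (avg (f n))| + `|Im (avg (f n))|)).
  by have := cvgD (cvg_norm R0) (cvg_norm I0); rewrite normr0 addr0; exact.
by move=> n; exact: normc_le_ReIm.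
Qed.

Lemma ccontinuous_cis (a : R) : ccontinuous (fun t => cis (a * t)).
Proof.
split => t; apply: continuous_comp; do ?[exact: mulrl_continuous];
  [exact: continuous_cos|exact: continuous_sin].
Qed.

Lemma avg_cis (m : int) : avg (fun t => cis (2 * pi * t) ^ m) = (m == 0)%:R.
Proof.
have [->|m0] := eqVneq m 0; first exact: avg_const.
pose a : R := m%:~R * (2 * pi).
have a0 : a != 0 by rewrite mulf_neq0 ?intr_eq0 // mulf_neq0 // gt_eqF // pi_gt0.
have -> : (fun t => cis (2 * pi * t) ^ m) = (fun t => cis (a * t)).
  by apply/funext => t; rewrite -cisMz mulrA.
have cisa : cis a = 1.
  rewrite /a cisMz (_ : cis (2 * pi) = 1) ?exp1rz //.
  by rewrite /cis mulr_natl cos2pi sin2pi.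
have [ca sa] : cos a = 1 /\ sin a = 0 by case: cisa.
(* The antiderivatives of [cos (a t)] and [sin (a t)] agree at 0 and 1 because [cis a = 1]. *)
have FTC (f F : R -> R) : continuous f -> (forall x : R, is_derive x 1 F (f x)) ->
    F 1 = F 0 -> \int[mu]_(t in I01) f t = 0.
  move=> cf dF F10.
  have dF' (x : R) : derivable F x 1 by have := dF x; case.
  have cF : continuous F.
    by move=> x; apply/differentiable_continuous/derivable1_diffP; exact: dF'.
  rewrite /Rintegral (@continuous_FTC2 _ f F 0 1) //=; first by rewrite F10 subrr.
  - exact: continuous_subspaceT.
  - by split=> [x _||]; [exact: dF'|apply: cvg_at_right_filter|apply: cvg_at_left_filter]; exact: cF.
  - by move=> x _; rewrite derive1E; have := dF x; case.
have lin (x : R) : is_derive x 1 (fun t => a * t) a.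
  have h : is_derive x 1 (a *: (@id R)) (a *: 1) by exact: is_deriveZ.
  by move: h; rewrite /GRing.scale /= mulr1.
have dcos (x : R) : is_derive x 1 (fun t => a^-1 * sin (a * t)) (cos (a * x)).
  have h := @is_derive1_comp R sin ( *%R a) x _ _ (is_derive_sin _) (lin x).
  have h' : is_derive x 1 (a^-1 *: (sin \o *%R a)) (a^-1 *: (cos (a * x) * a)) by exact: is_deriveZ.
  have E : a^-1 *: (cos (a * x) * a) = cos (a * x) by rewrite -[LHS]/(_ * _) mulrCA mulVf ?mulr1.
  by move: h'; rewrite E.
have dsin (x : R) : is_derive x 1 (fun t => - a^-1 * cos (a * t)) (sin (a * x)).
  have h := @is_derive1_comp R cos ( *%R a) x _ _ (is_derive_cos _) (lin x).
  have h' : is_derive x 1 (- a^-1 *: (cos \o *%R a)) (- a^-1 *: (- sin (a * x) * a)).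
    exact: is_deriveZ.
  have E : - a^-1 *: (- sin (a * x) * a) = sin (a * x).
    by rewrite -[LHS]/(_ * _) mulNr mulNr mulrN opprK mulrCA mulVf ?mulr1.
  by move: h'; rewrite E.
have [c1 c2] := ccontinuous_cis a.
rewrite /avg /= (FTC _ _ c1 dcos) ?(FTC _ _ c2 dsin) //.
  by rewrite mulr1 mulr0 ca cos0.
by rewrite mulr1 mulr0 sa sin0.
Qed.

End CircleAverage.
(** * From the line to the lattice *)

Section Bloch.
Variables (R : realType) (d N : nat).
Local Notation C := R[i].
Local Notation lat := ('rV[int]_d).
Variables (tau : 'I_N -> lat) (K : 'M[C]_N) (v : lat) (s : 'I_N -> bool).

Definition dot (x y : lat) : int := \sum_i x ord0 i * y ord0 i.

Lemma dotD x y z : dot x (y + z) = dot x y + dot x z.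
Proof. by rewrite -big_split; apply: eq_bigr => i _; rewrite mxE mulrDr. Qed.

Definition unimodular (u : 'I_d -> C) := forall i, u i * (u i)^* = 1.

Definition character (u : 'I_d -> C) (x : lat) : C := \prod_i u i ^ x ord0 i.

Lemma characterD u x y : unimodular u ->
  character u (x + y) = character u x * character u y.
Proof.
move=> hu; rewrite -big_split; apply: eq_bigr => i _.
by rewrite mxE expfzDr // unit_circle_neq0.
Qed.

Lemma character_unit u x : unimodular u -> character u x * (character u x)^* = 1.
Proof.
move=> hu; rewrite rmorph_prod -big_split big1 // => i _ /=.
by rewrite fmorphXz -expfzMl hu exp1rz.
Qed.

Lemma normc_unit (z : C) : z * z^* = 1 -> normc z = 1.
Proof.
rewrite -normCK => /eqP; rewrite sqrp_eq1 // => /eqP h.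
by apply: (@complexI R); rewrite -[LHS]/(`|z|) h.
Qed.

Definition fiber_coin u : 'M[C]_N := \matrix_(c, k) (character u (tau c) * K c k).

(** Reading at [x + tau c] multiplies the character by a phase, absorbed into [fiber_coin], and
    changes [dot v x] by [step s c]. *)
Lemma gevol_character u (phi : int -> 'cV[C]_N) : unimodular u ->
  (forall c, dot v (tau c) = step s c) -> forall n,
  iter n (gevol tau K) (fun x => character u x *: phi (dot v x)) =
  fun x => character u x *: iter n (gevol (step s) (fiber_coin u)) phi (dot v x).
Proof.
move=> hu htau; elim=> //= n ->; apply/funext => x; apply/colP => c.
rewrite gevolE mxE gevolE mulr_sumr; apply: eq_bigr => k _.
by rewrite !mxE characterD // dotD htau; ring.
Qed.

Definition avg_config (F : R -> lat -> 'cV[C]_N) : lat -> 'cV[C]_N :=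
  fun x => \col_c avg (fun t => F t x c ord0).

Definition config_continuous (F : R -> lat -> 'cV[C]_N) :=
  forall x c, ccontinuous (fun t => F t x c ord0).

Lemma gevol_continuous F : config_continuous F ->
  config_continuous (fun t => gevol tau K (F t)).
Proof.
move=> cF x c; rewrite (_ : (fun t => _) = fun t => \sum_k K c k * F t (x + tau c) k ord0).
  by apply: ccontinuous_sum => k; exact: ccontinuousZ.
by apply/funext => t; rewrite gevolE.
Qed.

Lemma gevol_avg F : config_continuous F ->
  gevol tau K (avg_config F) = avg_config (fun t => gevol tau K (F t)).
Proof.
move=> cF; apply/funext => x; apply/colP => c; rewrite gevolE mxE.
rewrite (_ : (fun t => _) = fun t => \sum_k K c k * F t (x + tau c) k ord0); last first.
  by apply/funext => t; rewrite gevolE.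
rewrite avg_sum; last by move=> k; exact: ccontinuousZ.
by apply: eq_bigr => k _; rewrite avgZ // mxE.
Qed.

Lemma iter_gevol_avg F n : config_continuous F ->
  config_continuous (fun t => iter n (gevol tau K) (F t)) /\
  iter n (gevol tau K) (avg_config F) = avg_config (fun t => iter n (gevol tau K) (F t)).
Proof.
move=> cF; elim: n => [|n [IHc IH]] //=; split; first exact: gevol_continuous.
by rewrite IH gevol_avg.
Qed.

Variable e : 'I_N.

(* The coordinates below [j] have already been integrated out. *)
Definition bloch_wave (j : nat) (u : 'I_d -> C) : lat -> 'cV[C]_N := fun x =>
  ((dot v x == 0)%:R * \prod_(i < d) (if (i < j)%N then (x ord0 i == 0)%:R else u i ^ x ord0 i))
    *: delta_mx e ord0.

Definition set_angle (u : 'I_d -> C) (j : 'I_d) (t : R) : 'I_d -> C :=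
  fun i => if i == j then cis (2 * pi * t) else u i.

Lemma set_angle_unimodular u j t : unimodular u -> unimodular (set_angle u j t).
Proof. by move=> hu i; rewrite /set_angle; case: eqP => // _; exact: cis_unit. Qed.

Let bloch_angle u (j : 'I_d) t x c :
  bloch_wave j (set_angle u j t) x c ord0 =
  ((dot v x == 0)%:R * (\prod_(i < d | i != j)
     (if (i < j)%N then (x ord0 i == 0)%:R else u i ^ x ord0 i)) *
   (delta_mx e ord0 : 'cV[C]_N) c ord0) * cis (2 * pi * t) ^ x ord0 j.
Proof.
rewrite mxE (bigD1 j) //= ltnn /set_angle eqxx.
under eq_bigr => i /negPf ij do rewrite ij.
by ring.
Qed.

Lemma bloch_wave_continuous u (j : 'I_d) :
  config_continuous (fun t => bloch_wave j (set_angle u j t)).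
Proof.
move=> x c; under eq_fun do rewrite bloch_angle -cisMz mulrA.
by apply: ccontinuousZ; exact: ccontinuous_cis.
Qed.

(** Orthogonality of characters: averaging [z ^ x_j] over the circle gives the indicator of
    [x_j = 0]. *)
Lemma bloch_wave_avg u (j : 'I_d) :
  bloch_wave j.+1 u = avg_config (fun t => bloch_wave j (set_angle u j t)).
Proof.
apply/funext => x; apply/colP => c; rewrite [RHS]mxE.
under eq_fun do rewrite bloch_angle.
rewrite avgZ; last first.
  by under eq_fun do rewrite -cisMz mulrA; exact: ccontinuous_cis.
rewrite avg_cis mxE (bigD1 j) //= ltnSn.
under eq_bigr => i ij do rewrite ltnS leq_eqVlt -[X in X || _]/(i == j) (negPf ij) /=.
by ring.
Qed.

Hypothesis unitaryK : adjmx K *m K = 1%:M.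
Hypothesis tau_step : forall c, dot v (tau c) = step s c.
Hypothesis minor_nondegenerate : forall y : 'cV[C]_N,
  (forall c, ~~ s c -> y c ord0 = 0) ->
  (forall c, s c -> (K *m y) c ord0 = 0) -> y = 0.

Lemma fiber_coin_unitary u : unimodular u -> adjmx (fiber_coin u) *m fiber_coin u = 1%:M.
Proof.
move=> hu; rewrite -unitaryK; apply/matrixP => i j; rewrite !mxE.
apply: eq_bigr => k _; rewrite !mxE rmorphM /= mulrACA -[RHS]mul1r; congr (_ * _).
by rewrite mulrC character_unit.
Qed.

Let line_delta (m : int) : 'cV[C]_N := (m == 0)%:R *: delta_mx e ord0.

Let line_delta_energy : (energy line_delta <= 1%:E)%E.
Proof.
rewrite /energy (esumID [set 0]) ?setTI; last by move=> m _; rewrite lee_fin sqnorm_ge0.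
rewrite esum_set1 ?lee_fin ?sqnorm_ge0 // [X in (_ + X)%E]esum1 ?adde0.
  rewrite lee_fin /sqnorm (bigD1 e) //= big1 => [|c /negPf ce].
    by rewrite /line_delta eqxx scale1r mxE !eqxx normc1 expr1n addr0.
  by rewrite /line_delta !mxE ce mulr0 normc0 expr0n.
move=> m /= /eqP/negPf m0; congr (_%:E); apply: big1 => c _.
by rewrite /line_delta m0 scale0r mxE normc0 expr0n.
Qed.

(** Induction on the number of averaged coordinates, starting from [line_decay]. The bound [2 ^+ j]
    is carried along as the dominating constant for [vanishes_avg] and doubles at each average. *)
Lemma bloch_wave_decay j u : (j <= d)%N -> unimodular u -> forall x c,
  (forall n, normc (iter n (gevol tau K) (bloch_wave j u) x c ord0) <= 2 ^+ j) /\
  vanishes (fun n => iter n (gevol tau K) (bloch_wave j u) x c ord0).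
Proof.
elim: j u => [|j IH] u le_jd hu x c.
  have E n : iter n (gevol tau K) (bloch_wave 0 u) x c ord0 =
      character u x * orbit_arr (fiber_coin u) s line_delta n (dot v x) c ord0.
    have -> : bloch_wave 0 u = fun x => character u x *: line_delta (dot v x).
      by apply/funext => z; rewrite /bloch_wave /line_delta scalerA mulrC.
    by rewrite gevol_character // mxE.
  have uF := fiber_coin_unitary hu; split=> [n|].
    rewrite E normcM normc_unit ?character_unit // mul1r expr0.
    have /(normc_le_energy (dot v x) c) : (energy
        (orbit_arr (fiber_coin u) s line_delta n) <= 1%:E)%E.
      by rewrite energy_iter //; exact: unitary_isometric.
    by rewrite -[X in _ <= X -> _](expr1n _ 2) ler_pXn2r ?nnegrE ?normc_ge0.
  under eq_fun do rewrite E; apply: vanishesZ; apply: line_decay => //.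
    (* Passing to the fiber coin multiplies each row by a nonzero phase, so nondegeneracy is
       inherited from [K]. *)
    move=> y y0 Ky; apply: minor_nondegenerate => // k sk; have := Ky k sk.
    have -> : (fiber_coin u *m y) k ord0 = character u (tau k) * (K *m y) k ord0.
      by rewrite !mxE mulr_sumr; apply: eq_bigr => i _; rewrite mxE mulrA.
    move/eqP; rewrite mulf_eq0 (negPf (unit_circle_neq0 _)) ?character_unit //.
    by move/eqP.
  by move=> m /negPf m0; rewrite /line_delta m0 scale0r.
pose k := Ordinal le_jd; have cB := bloch_wave_continuous u k.
have hk t := IH (set_angle u k t) (ltnW le_jd) (set_angle_unimodular k t hu) x c.
have E n : iter n (gevol tau K) (bloch_wave j.+1 u) x c ord0 =
    avg (fun t => iter n (gevol tau K) (bloch_wave j (set_angle u k t)) x c ord0).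
  rewrite -[j.+1]/(k.+1) bloch_wave_avg.
  by have [_ ->] := iter_gevol_avg n cB; rewrite mxE.
have cn n : ccontinuous (fun t => iter n (gevol tau K) (bloch_wave j (set_angle u k t)) x c ord0).
  by have [h _] := iter_gevol_avg n cB; exact: h.
split=> [n|].
  by rewrite E exprS; apply: normc_avg_le => // t; exact: (hk t).1.
under eq_fun do rewrite E; apply: (@vanishes_avg _ _ (2 ^+ j)) => // [n t|t].
  exact: (hk t).1.
exact: (hk t).2.
Qed.

Theorem delta_decay x c :
  vanishes (fun n => iter n (gevol tau K) (fun y => (y == 0)%:R *: delta_mx e ord0) x c ord0).
Proof.
have hu : unimodular (fun=> 1) by move=> i; rewrite rmorph1 mulr1.
have [_] := bloch_wave_decay (leqnn d) hu x c.
(* With all coordinates averaged, the product is the indicator of the origin. *)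
suff -> : bloch_wave d (fun=> 1) = (fun y => (y == 0)%:R *: delta_mx e ord0) by [].
apply/funext => y; rewrite /bloch_wave; congr (_ *: _).
have [->|y0] := eqVneq y 0.
  rewrite /dot !big1 ?mulr1 ?eqxx // => i _; rewrite mxE ?mulr0 //.
  by rewrite ltn_ord eqxx.
have [i yi] : exists i, y ord0 i != 0 by apply/rV0Pn.
by rewrite (bigD1 i) //= ltn_ord (negPf yi) mul0r mulr0.
Qed.

End Bloch.
(** * The Fourier coin *)

Section FourierCoin.
Variables (R : realType) (d : nat).
Hypothesis d_gt0 : (0 < d)%N.
Local Notation C := R[i].
Local Notation w := (omega R d).

Lemma omega_cis : w = cis (pi / d%:R). Proof. by []. Qed.

Lemma omega_primitive : (2 * d).-primitive_root w.
Proof.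
have d0 : d%:R != 0 :> R by rewrite pnatr_eq0 -lt0n.
have w2d : w ^+ (2 * d) = 1.
  rewrite omega_cis -cisMn (_ : _ * _ = pi *+ 2) /cis ?cos2pi ?sin2pi //.
  by rewrite natrM -[RHS]mulr_natl; field.
rewrite /primitive_root_of_unity muln_gt0 d_gt0 /=; apply/forallP => i.
rewrite unity_rootE; apply/eqP; have [->|ne] := eqVneq i.+1 (2 * d)%N.
  by rewrite w2d !eqxx.
(* Write the angle as [2 a] with [0 < a < pi]: real part 1 would force [sin a = 0]. *)
apply/negbTE/eqP; rewrite omega_cis -cisMn => -[].
have -> : i.+1%:R * (pi / d%:R) = (i.+1%:R / (2 * d)%:R * pi : R) *+ 2.
  by rewrite natrM -[RHS]mulr_natl; field.
set a := _ * pi; rewrite cos_mulr2n cos2sin2 => h _.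
have sa : 0 < sin a.
  have d2 : 0 < (2 * d)%:R :> R by rewrite ltr0n muln_gt0.
  apply: sin_gt0_pi; rewrite mulr_gt0 ?divr_gt0 ?pi_gt0 ?ltr0n ?muln_gt0 ?d_gt0 //=.
  by rewrite gtr_pMl ?pi_gt0 // ltr_pdivrMr // mul1r ltr_nat ltn_neqAle ne ltn_ord.
have : 0 < sin a ^+ 2 by rewrite exprn_gt0.
by rewrite mulr2n in h; move: h; lra.
Qed.

(** The product of two columns is a geometric sum whose ratio is a [2 d]-th root of unity, different
    from 1 off the diagonal. *)
Lemma fourier_coin_unitary : adjmx (fourier_coin R d) *m fourier_coin R d = 1%:M.
Proof.
have d2 : 0 < (2 * d)%:R :> R by rewrite ltr0n muln_gt0.
have ww : w * w^* = 1 by rewrite omega_cis cis_unit.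
have w0 : w != 0 by exact: unit_circle_neq0.
have wJ : w^* = w^-1 by apply: (mulfI w0); rewrite ww divff.
apply/matrixP => a b; rewrite !mxE.
pose k : C := ((Num.sqrt ((2 * d)%:R : R))^-1)%:C%C.
have kk : k * k = ((2 * d)%:R)^-1.
  rewrite /k -rmorphM -expr2 exprVn sqr_sqrtr ?ler0n //.
  by rewrite fmorphV rmorph_nat.
have kJ : k^* = k by rewrite conj_Creal // /k complex_real.
have E (j : 'I_(2 * d)) : adjmx (fourier_coin R d) a j * fourier_coin R d j b =
    k * k * (w ^+ b / w ^+ a) ^+ j.
  rewrite !mxE rmorphM rmorphXn /= -/k kJ wJ mulrACA; congr (_ * _).
  by rewrite [RHS]exprMn !exprVn -!exprM mulrC ![(j * _)%N]mulnC.
under eq_bigr do rewrite E.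
rewrite -mulr_sumr kk; set z := _ / _.
have [ab|ab] := eqVneq a b.
  rewrite /z ab; under eq_bigr => j _.
    rewrite divff ?expf_neq0 // expr1n; over.
  by rewrite sumr_const card_ord mulVf // pnatr_eq0 -lt0n muln_gt0.
rewrite mulr0n; apply/eqP; rewrite mulf_eq0 invr_eq0 pnatr_eq0 -leqn0 leqNgt muln_gt0 /=.
rewrite d_gt0 /=; have z1 : z - 1 != 0.
  rewrite subr_eq0; apply: contra ab => /eqP zE.
  have : w ^+ b == w ^+ a.
    by rewrite -subr_eq0 -(divfK (expf_neq0 a w0) (w ^+ b)) -/z zE mul1r subrr.
  rewrite (eq_prim_root_expr omega_primitive) !modn_small // => /eqP ba.
  by apply/eqP/val_inj.
have w1 m : (w ^+ m) ^+ (2 * d) = 1.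
  by rewrite exprAC (prim_expr_order omega_primitive) expr1n.
by rewrite -(inj_eq (mulfI z1)) mulr0 -subrX1 subr_eq0 /z exprMn exprVn !w1 divr1.
Qed.

(* One component from each pair [{2j, 2j+1}]: the residues of [(d + 1) i]
   modulo [2 d] for [i < d]. *)
Definition coin_half (c : nat) : bool := odd c == (d <= c)%N && ~~ odd d.

(** For odd [d] the selected indices are the even ones. For even [d] both members of the pair lie on
    the same side of [d], so parity separates them. *)
Lemma coin_half_pair j : (j < d)%N -> coin_half j.*2.+1 = ~~ coin_half j.*2.
Proof.
move=> lt_jd; rewrite /coin_half /= odd_double /=.
case: (boolP (odd d)) => od; first by rewrite !andbF.
rewrite !andbT; have -> : (d <= j.*2.+1)%N = (d <= j.*2)%N.
  rewrite leq_eqVlt ltnS (_ : (d == _) = false) //.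
  by apply: contraNF od => /eqP ->; rewrite /= odd_double.
by case: leqP.
Qed.

(** This is [(d + 1) i] modulo [2 d], since [d i] modulo [2 d] depends only on the parity of [i]. *)
Let half_index (i : nat) : nat := (i + d * odd i)%N.

Let half_index_lt i : (i < d)%N -> (half_index i < 2 * d)%N.
Proof. by rewrite /half_index; case: (odd i); lia. Qed.

Let half_ord (i : 'I_d) : 'I_(2 * d) := Ordinal (half_index_lt (ltn_ord i)).

Let coin_half_index (i : 'I_d) : coin_half (half_ord i).
Proof.
rewrite /coin_half /= /half_index; case oi: (odd i).
  by rewrite muln1 oddD oi leq_addl /=; case: (odd d).
by rewrite muln0 addn0 oi leqNgt ltn_ord.
Qed.

Let half_ord_mod (i : 'I_d) : (half_ord i %% d = i)%N.
Proof. by rewrite /= /half_index addnC mulnC modnMDl modn_small. Qed.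

Let half_mod_ord (c : 'I_(2 * d)) : coin_half c ->
  half_ord (Ordinal (ltn_pmod c d_gt0)) = c.
Proof.
move=> hc; apply: val_inj; rewrite /= /half_index.
have [lt_cd|le_dc] := ltnP c d.
  move: hc; rewrite /coin_half leqNgt lt_cd /= => /eqP oc.
  by rewrite modn_small // oc muln0 addn0.
have -> : (c %% d = c - d)%N.
  by rewrite -{1}(subnK le_dc) modnDr modn_small //; have := ltn_ord c; lia.
move: hc; rewrite /coin_half le_dc /= => /eqP oc.
by rewrite oddB // oc; case: (odd d) => /=; rewrite ?muln1 ?muln0; lia.
Qed.


Let half_index_mod (i : nat) : half_index i = (d.+1 * i)%N %[mod 2 * d].
Proof.
have -> : (d.+1 * i = i./2 * (2 * d) + half_index i)%N.
  rewrite /half_index mulSn -{2}(odd_double_half i) -mul2n; ring.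
by rewrite modnMDl.
Qed.

(** Up to the scalar of the coin, the selected submatrix is the Vandermonde matrix with nodes
    [w ^+ (d.+1 ^ 2 * i)]. *)
Let omega_half (i k : 'I_d) :
  w ^+ (half_ord i * half_ord k) = (w ^+ (d.+1 ^ 2 * i)) ^+ k.
Proof.
rewrite -exprM; apply/eqP; rewrite (eq_prim_root_expr omega_primitive) /=.
by rewrite -modnMml -modnMmr !half_index_mod modnMml modnMmr; apply/eqP; congr (_ %% _)%N; ring.
Qed.

(** Equal nodes give [i = k] modulo [d], because [d + 1] is coprime to [d]. *)
Let omega_half_inj : injective (fun i : 'I_d => w ^+ (d.+1 ^ 2 * i)).
Proof.
have cop : coprime d (d.+1 ^ 2) by rewrite coprimeXr // coprimenS.
move=> i k /= /eqP; rewrite (eq_prim_root_expr omega_primitive).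
wlog le_ik : i k / (i <= k)%N.
  move=> h; case/orP: (leq_total i k) => [/h //|/h h' E].
  by apply/esym/h'; rewrite eq_sym.
rewrite eq_sym eqn_mod_dvd ?leq_mul // -mulnBr => /(dvdn_trans (dvdn_mull 2 (dvdnn d))).
rewrite Gauss_dvdr // => dv; apply/val_inj/eqP; rewrite eqn_leq le_ik /= -subn_eq0.
rewrite -leqn0 leqNgt; apply/negP => pos; have := dvdn_leq pos dv.
by have := ltn_ord k; lia.
Qed.

(** The selected entries of [y] are the coefficients of a polynomial of degree less than [d] that
    vanishes at the [d] distinct nodes. *)
Lemma fourier_minor_nondegenerate (y : 'cV[C]_(2 * d)) :
  (forall c : 'I_(2 * d), ~~ coin_half c -> y c ord0 = 0) ->
  (forall c : 'I_(2 * d), coin_half c -> (fourier_coin R d *m y) c ord0 = 0) -> y = 0.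
Proof.
move=> y0 Cy; pose q : {poly C} :=
  \poly_(k < d) oapp (fun k : 'I_d => y (half_ord k) ord0) 0 (insub k).
have qE z : q.[z] = \sum_(k < d) y (half_ord k) ord0 * z ^+ k.
  by rewrite horner_poly; apply: eq_bigr => k _; rewrite valK.
have q_root i : q.[w ^+ (d.+1 ^ 2 * (i : 'I_d))] = 0.
  have k0 : ((Num.sqrt ((2 * d)%:R : R))^-1)%:C%C != 0 :> C.
    by rewrite -(rmorph0 (real_complex R)) (inj_eq (@complexI R)) invr_eq0 sqrtr_eq0 -ltNge
      ltr0n muln_gt0.
  have := Cy (half_ord i) (coin_half_index i); rewrite mxE => E.
  apply: (mulfI k0); rewrite mulr0 -[RHS]E qE mulr_sumr.
  rewrite [RHS](bigID (fun c : 'I_(2 * d) => coin_half c)) /=.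
  rewrite [X in _ = _ + X]big1 ?addr0; last by move=> c /y0 ->; rewrite mulr0.
  rewrite (reindex_onto half_ord (fun c : 'I_(2 * d) => Ordinal (ltn_pmod c d_gt0)));
    last exact: half_mod_ord.
  apply: eq_big => [k|k _].
    rewrite coin_half_index; apply/esym/eqP/val_inj; exact: half_ord_mod.
  by rewrite mxE omega_half [y _ _ * _]mulrC mulrA.
have q0 : q = 0.
  apply/eqP/negPn/negP => q0.
  have := max_poly_roots q0 (rs := [seq w ^+ (d.+1 ^ 2 * (i : 'I_d)) | i <- enum 'I_d]).
  rewrite size_map size_enum_ord => h.
  have : (d < size q)%N.
    apply: h; first by apply/allP => _ /mapP[i _ ->]; rewrite /root q_root.
    by rewrite map_inj_uniq ?enum_uniq //; exact: omega_half_inj.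
  by rewrite ltnNge size_poly.
apply/colP => c; rewrite mxE; have [hc|] := boolP (coin_half c); last exact: y0.
rewrite -(half_mod_ord hc); set k := Ordinal _.
by have := coef0 C k; rewrite -q0 coef_poly ltn_ord valK.
Qed.

End FourierCoin.

(** * The lattice walk seen along a direction adapted to the coin *)

Section WalkDirection.
Variable d : nat.

Definition coin_shift (c : 'I_(2 * d)) : lattice d :=
  if odd c then - unit_vec d c./2 else unit_vec d c./2.

Lemma evol_gevol (R : realType) (K : 'M[R[i]]_(2 * d)) : evol K = gevol coin_shift K.
Proof.
apply/funext => psi; apply/funext => x; apply/colP => c.
by rewrite /evol /gevol /coin_shift !mxE; case: (odd c).
Qed.

(** The signs are chosen so that in each pair of opposite shifts the component in [coin_half] is the
    one with step -1. *)
Definition direction : lattice d := \row_(j < d) (if coin_half d j.*2 then -1 else 1).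

Lemma dot_coin_shift (c : 'I_(2 * d)) :
  dot direction (coin_shift c) = step (fun c : 'I_(2 * d) => coin_half d c) c.
Proof.
have lt_c : (c./2 < d)%N by rewrite ltn_half_double -mul2n.
have dot_unit : dot direction (unit_vec d c./2) = if coin_half d c./2.*2 then -1 else 1.
  rewrite /dot (bigD1 (Ordinal lt_c)) //= !mxE eqxx mulr1 big1 ?addr0 // => i ne.
  by rewrite !mxE (_ : (i == c./2 :> nat) = false) ?mulr0 //; exact: negbTE.
have dotN x y : dot x (- y) = - dot x y :> int.
  by rewrite -sumrN; apply: eq_bigr => i _; rewrite mxE mulrN.
have E : coin_half d c = odd c (+) coin_half d c./2.*2.
  by rewrite -{1}(odd_double_half c); case: (odd c); rewrite ?coin_half_pair.
rewrite /step E /coin_shift; case: (odd c); rewrite ?dotN dot_unit /=;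
  by case: (coin_half _ _).
Qed.

End WalkDirection.

(** * From point masses to all configurations of finite energy *)

Section ApproximationByFiniteSupport.
Variables (R : realType) (L : zmodType) (N : nat) (tau : 'I_N -> L) (K : 'M[R[i]]_N).
Hypothesis isoK : isometric K.
Hypothesis delta_vanishes : forall e x c, vanishes (fun n =>
  iter n (gevol tau K) (fun y => (y == 0)%:R *: delta_mx e ord0) x c ord0).

Let finite_config (psi : L -> 'cV[R[i]]_N) (X : seq L) : L -> 'cV[R[i]]_N :=
  fun x => \sum_(yk <- [seq (y, k) | y <- X, k <- index_enum 'I_N])
     psi yk.1 yk.2 ord0 *: ((x - yk.1 == 0)%:R *: delta_mx yk.2 ord0).

Let finite_config_vanishes psi X x c : vanishes (fun n =>
  iter n (gevol tau K) (finite_config psi X) x c ord0).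
Proof.
have E n : iter n (gevol tau K) (finite_config psi X) x c ord0 =
    \sum_(yk <- [seq (y, k) | y <- X, k <- index_enum 'I_N]) psi yk.1 yk.2 ord0 *
      iter n (gevol tau K) (fun y => (y == 0)%:R *: delta_mx yk.2 ord0) (x - yk.1) c ord0.
  rewrite iter_gevol_sum summxE; apply: eq_bigr => yk _; rewrite mxE.
  by rewrite (iter_gevol_shift tau K (fun y => (y == 0)%:R *: delta_mx yk.2 ord0) (- yk.1)).
under eq_fun do rewrite E.
by apply: vanishes_sum => yk _; apply: vanishesZ; exact: delta_vanishes.
Qed.

Let finite_configE psi X x : uniq X ->
  finite_config psi X x = if x \in X then psi x else 0.
Proof.
move=> uX; rewrite /finite_config big_allpairs /=.
have inner y : \sum_k psi y k ord0 *: ((x - y == 0)%:R *: delta_mx k ord0) =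
    if y == x then psi x else 0 :> 'cV[R[i]]_N.
  rewrite subr_eq0 eq_sym; case: eqP => [->|_]; last first.
    by apply: big1 => k _; rewrite scale0r scaler0.
  apply/colP => c; rewrite summxE (bigD1 c) //= big1 => [|k kc].
    by rewrite addr0 !mxE !eqxx !mulr1.
  by rewrite !mxE eq_sym (negPf kc) mulr0 mulr0.
under eq_bigr do rewrite inner.
rewrite -big_mkcond /=; case: ifP => xX.
  by rewrite -big_filter filter_pred1_uniq // big_seq1.
by rewrite big1_seq // => y /andP[/eqP ->]; rewrite xX.
Qed.

(** Cut [psi] at a finite set outside which the energy is at most [(e / 2)^2]. The finite part
    decays by linearity, and the tail stays below [e / 2] at all times because the evolution
    preserves energy. *)
Lemma finite_energy_vanishes psi x c : (energy psi < +oo)%E ->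
  vanishes (fun n => iter n (gevol tau K) psi x c ord0).
Proof.
move=> psi_fin e e0.
have e2 : 0 < e / 2 by rewrite divr_gt0.
have d0 : 0 < (e / 2) ^+ 2 by rewrite exprn_gt0.
have E_fin : energy psi \is a fin_num.
  by rewrite ge0_fin_numE // esum_ge0 // => y _; rewrite lee_fin sqnorm_ge0.
have [_ [X [finX _] <-] hX] := ub_ereal_sup_adherent d0 E_fin.
have [r XE] : exists r : seq L, X = [set` r] by apply/finite_seqP.
set chi := finite_config psi (undup r).
have tail : (energy (fun y => psi y - chi y)%R <= ((e / 2) ^+ 2)%:E)%E.
  have -> : energy (fun y => psi y - chi y) = (\esum_(y in ~` X) (sqnorm (psi y))%:E)%E.
    rewrite [RHS]esum_mkcond; apply: eq_esum => y _.
    rewrite /chi finite_configE ?undup_uniq // mem_undup in_setC XE mem_setE.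
    case: (y \in r) => /=; last by rewrite subr0.
    by rewrite subrr /sqnorm big1 // => k _; rewrite mxE normc0 expr0n.
  have sq_ge0 y : (0 <= (sqnorm (psi y))%:E)%E by rewrite lee_fin sqnorm_ge0.
  have split_X : energy psi = (\sum_(y \in X) (sqnorm (psi y))%:E +
      \esum_(y in ~` X) (sqnorm (psi y))%:E)%E.
    by rewrite /energy (esumID X) // !setTI esum_fset.
  have {}hX : (energy psi - ((e / 2) ^+ 2)%:E < \sum_(y \in X) (sqnorm (psi y))%:E)%E := hX.
  move: hX E_fin; rewrite split_X; set A := (\sum_(_ \in _) _)%E; set B := (\esum_(_ in _) _)%E.
  move=> hX; rewrite fin_numD => /andP[]; move: hX; case: A => // a; case: B => // b.
  move=> h _ _; have : a + b - (e / 2) ^+ 2 < a by rewrite -lte_fin; exact: h.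
  by rewrite lee_fin; lra.
near=> n.
(* The two-term sum is indexed by booleans to fit the linearity lemma [iter_gevol_sum]. *)
have -> : psi = fun y => \sum_(b : bool) 1 *: (if b then chi else fun z => psi z - chi z) y.
  by apply/funext => y; rewrite big_bool /= !scale1r addrC subrK.
rewrite iter_gevol_sum big_bool /= !scale1r mxE.
apply: (le_lt_trans (normcD _ _)); rewrite [e]splitr; apply: ltr_leD.
  by near: n; exact: finite_config_vanishes.
have : (energy (iter n (gevol tau K) (fun y => psi y - chi y)%R) <= ((e / 2) ^+ 2)%:E)%E.
  by rewrite energy_iter.
move/(normc_le_energy x c); rewrite ler_pXn2r ?nnegrE ?normc_ge0 //.
exact: ltW.
Unshelve. all: by end_near. Qed.

End ApproximationByFiniteSupport.

(** * Absence of localization for the Fourier walk *)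

Theorem theorem1 (R : realType) (d : nat) (hd : (1 <= d)%N)
    (Psi0 : config R d) (hPsi0 : in_H Psi0) (x : lattice d) :
  limn_esup (fun n => (vnorm (walk (fourier_coin R d) n Psi0 x))%:E) = 0%E.
Proof.
have uC := fourier_coin_unitary R hd.
have isoC := unitary_isometric uC.
have vnorm2 (v : state R d) : vnorm v ^+ 2 = sqnorm v.
  by rewrite sqr_sqrtr // sqnorm_ge0.
have fin_energy : (energy Psi0 < +oo)%E.
  by rewrite /energy; under eq_esum => y _ do rewrite -vnorm2; exact: hPsi0.
have walk_vanishes c : vanishes (fun n => walk (fourier_coin R d) n Psi0 x c ord0).
  rewrite /walk evol_gevol; apply: finite_energy_vanishes => // e y k.
  apply: (@delta_decay R d (2 * d) (@coin_shift d) (fourier_coin R d) (direction d)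
    (fun c => coin_half d c) e) => //.
    exact: dot_coin_shift.
  exact: fourier_minor_nondegenerate.
suff lim0 : (vnorm (walk (fourier_coin R d) n Psi0 x))%:E @[n --> \oo] --> 0%E.
  by have [_] := cvg_limn_einf_sup lim0.
apply: cvg_EFin; first exact: nearW.
have vnorm_le (v : state R d) : vnorm v <= \sum_c normc (v c ord0).
  rewrite -[leRHS]ger0_norm ?sumr_ge0 // => [|c _]; last exact: normc_ge0.
  rewrite -sqrtr_sqr ler_sqrt ?sqr_ge0 // expr2 mulr_suml; apply: ler_sum => c _.
  rewrite expr2 ler_wpM2l ?normc_ge0 // (bigD1 c) //= lerDl.
  by apply: sumr_ge0 => k _; exact: normc_ge0.
apply/cvgrPdist_lt => e e0.
(* Dividing by [2 d + 1] keeps the sum of the [2 d] component bounds strictly below [e]. *)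
have e2 : 0 < e / (2 * d).+1%:R by rewrite divr_gt0.
have small : \forall n \near \oo, forall c : 'I_(2 * d),
    normc (walk (fourier_coin R d) n Psi0 x c ord0) < e / (2 * d).+1%:R.
  by apply: filter_forall => c; exact: walk_vanishes.
apply: filterS small => n hn.
rewrite sub0r normrN ger0_norm ?sqrtr_ge0 //; apply: (le_lt_trans (vnorm_le _)).
apply: (@le_lt_trans _ _ (\sum_(c < 2 * d) e / (2 * d).+1%:R)).
  by apply: ler_sum => c _; exact: ltW.
rewrite sumr_const card_ord -[_ *+ (2 * d)]mulr_natr mulrAC -mulrA gtr_pMr //.
by rewrite ltr_pdivrMr // mul1r ltr_nat.
Qed.
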